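(* Let $K$ be a non-Archimedean local field, $n\ge1$, $\alpha>0$, $N\in\mathbb Z$, $\Omega=B_N=\{x\in K^n:\|x\|_{K^n}\le q^N\}$, $\Omega^c=K^n\setminus\Omega$. Suppose that $f\in L^2(\Omega)$, $g\in L^1(K^n\setminus\Omega)$ are real-valued, and that there exists a bounded locally constant function $\psi$ on $K^n$ such that $\mathcal N_\alpha\psi=g$ on $K^n\setminus\Omega$. Then the Neumann problem $$D^{\alpha,n}u=f\ \text{ on }\Omega,\qquad \mathcal N_\alpha u=g\ \text{ on }\Omega^c$$ has a weak solution in $H^{\alpha}_{\Omega,0}$ if and only if $$\int_\Omega f(x)\,dx=-\int_{K^n\setminus\Omega}g(y)\,dy .$$ If this equality is satisfied, then the weak solution is unique up to an additive constant.
   Context: $K$ is a non-Archimedean local field with residue field of cardinality $q$ and normalized absolute value $|\cdot|_K$ (its nonzero values are exactly $q^m$, $m\in\mathbb Z$). On $K^n$ use the norm $\|(x_1,\dots,x_n)\|_{K^n}=\max_{1\le j\le n}|x_j|_K$ and the Haar measure $dx$ (product of the Haar measures on $K$ normalized so that the ring of integers has measure $1$), extended to a complete measure. Put $c_{n,\alpha}=\dfrac{q^\alpha-1}{1-q^{-\alpha-n}}$. A function $\psi$ on $K^n$ is locally constant if there is an integer $\ell$ such that for every $x\in K^n$, $\psi(x+x')=\psi(x)$ whenever $\|x'\|_{K^n}\le q^{-\ell}$. The operators in the Neumann problem are $(D^{\alpha,n}u)(x)=c_{n,\alpha}\int_{K^n}\frac{u(x)-u(y)}{\|x-y\|_{K^n}^{n+\alpha}}\,dy$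 for $x\in\Omega$ and $(\mathcal N_\alpha u)(x)=c_{n,\alpha}\int_{\Omega}\frac{u(x)-u(y)}{\|x-y\|_{K^n}^{n+\alpha}}\,dy$ for $x\in K^n\setminus\Omega$. For $\rho\in L^1(K^n\setminus\Omega)$, $H^{\alpha}_{\Omega,\rho}$ is the space of measurable functions $u:K^n\to\mathbb R$ (identified when equal a.e.) with $$\|u\|_{H^{\alpha}_{\Omega,\rho}}=\Big\{\|u\|^2_{L^2(\Omega)}+\big\||\rho|^{1/2}u\big\|^2_{L^2(K^n\setminus\Omega)}+\int_{(K^n\times K^n)\setminus(\Omega^c\times\Omega^c)}\frac{|u(x)-u(y)|^2}{\|x-y\|_{K^n}^{n+\alpha}}\,dx\,dy\Big\}^{1/2}<\infty .$$ In particular $H^{\alpha}_{\Omega,0}$ is the case $\rho=0$ and $H^{\alpha}_{\Omega,g}$ the case $\rho=g$. A weak solution of the Neumann problem with data $f\in L^2(\Omega)$, $g\in L^1(K^n\setminus\Omega)$ is by definition a function $u\in H^{\alpha}_{\Omega,0}$ such that for each $v\in H^{\alpha}_{\Omega,g}$ $$\frac{c_{n,\alpha}}{2}\int_{(K^n\times K^n)\setminus(\Omega^c\times\Omega^c)}\frac{(u(x)-u(y))(v(x)-v(y))}{\|x-y\|_{K^n}^{n+\alpha}}\,dx\,dy=\int_\Omega f(x)v(x)\,dx+\int_{K^n\setminus\Omega}g(y)v(y)\,dy .$$ *)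

(* Defs.v *)
From HB Require Import structures.
From mathcomp Require Import all_boot all_order all_algebra.
From mathcomp Require Import all_classical all_reals all_analysis.

Set Implicit Arguments.
Unset Strict Implicit.
Unset Printing Implicit Defensive.

Import Order.TTheory GRing.Theory Num.Theory.
Import numFieldNormedType.Exports.

Local Open Scope classical_set_scope.
Local Open Scope ring_scope.

(* K is complete for the discrete absolute value abs, whose residue field
   O / P, with O = {abs <= 1} and P = {abs < 1}, has q elements; abs is
   normalized by the requirement that its nonzero values are the q ^ m. *)
Record nonarch_local_field (R : realType) (K : fieldType) (abs : K -> R)
    (q : nat) : Prop := NonarchLocalField {
  abs_eq0 : forall x, (abs x == 0) = (x == 0) ;
  absM : forall x y, abs (x * y) = abs x * abs y ;
  abs_ultra : forall x y, abs (x + y) <= Num.max (abs x) (abs y) ;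
  abs_values : abs @` [set x | x != 0] = range (fun m : int => q%:R ^ m) ;
  abs_complete : forall s : nat -> K,
    (forall e : R, 0 < e -> exists k, forall i j : nat,
       (k <= i)%N -> (k <= j)%N -> abs (s i - s j) < e) ->
    exists l, forall e : R, 0 < e -> exists k, forall i : nat,
       (k <= i)%N -> abs (s i - l) < e ;
  (* the elements of O / P, as cosets a + P *)
  abs_residue : ((fun a => [set x | abs (x - a) < 1]) @` [set a | abs a <= 1]
                   #= `I_q)%card
}.

Definition maxnorm (R : realType) (K : fieldType) (abs : K -> R) (n : nat)
    (x : 'rV[K]_n) : R :=
  \big[Num.max/0]_(j < n) abs (x ord0 j).

Section Borel.
Context {R : realType} {V : zmodType} (nrm : V -> R).

Definition norm_open : set (set V) :=
  [set U | forall x, U x ->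
     exists2 r, 0 < r & forall y, nrm (y - x) < r -> U y].

Definition borel : measurableType _ := g_sigma_algebraType norm_open.

End Borel.

Section Haar.
Context {R : realType} {K : fieldType} (abs : K -> R).

Definition normalized_haar (lambda : set (borel abs) -> \bar R) : Prop :=
  (forall (a : K) (A : set (borel abs)), measurable A ->
     lambda [set a + x | x in A] = lambda A) /\
  lambda [set x | abs x <= 1] = 1%E.

Definition is_product_measure (n : nat) (lambda : set (borel abs) -> \bar R)
    (mu : set (borel (@maxnorm R K abs n)) -> \bar R) : Prop :=
  forall A : 'I_n -> set (borel abs), (forall i, measurable (A i)) ->
    mu [set x : 'rV[K]_n | forall i, A i (x ord0 i)]
    = (\prod_(i < n) lambda (A i))%E.

End Haar.

Section Neumann.
Context {R : realType} {K : fieldType} (abs : K -> R) (q n : nat).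
Variable mu : {sigma_finite_measure set (borel (@maxnorm R K abs n)) -> \bar R}.
Context (alpha : R) (N : int).

Local Notation norm := (@maxnorm R K abs n).

(* K^n with the sigma-algebra of the completion of mu *)
Definition Kn : measurableType _ := caratheodory_type (mu^*)%mu.

Definition haarc : set Kn -> \bar R := @completed_measure_extension _ _ _ mu.

HB.instance Definition _ := Measure.on haarc.

Lemma haarc_sigma_finite : sigma_finite setT haarc.
Proof. exact/completed_measure_extension_sigma_finite/sigma_finiteT. Qed.

HB.instance Definition _ :=
  @Measure_isSigmaFinite.Build _ _ _ haarc haarc_sigma_finite.

Definition Omega : set Kn := [set x | norm x <= q%:R ^ N].

Definition cna : R :=
  (q%:R `^ alpha - 1) / (1 - q%:R `^ (- alpha - n%:R)).

(* The value on the diagonal is 0, by x / 0 = 0. *)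
Definition jump_kernel (x y : 'rV[K]_n) : R := (norm (x - y) `^ (n%:R + alpha))^-1.

Definition locally_constant (psi : 'rV[K]_n -> R) : Prop :=
  exists l : int, forall x x' : 'rV[K]_n,
    norm x' <= q%:R ^ (- l) -> psi (x + x') = psi x.

Definition Nalpha (u : Kn -> R) (x : Kn) : R :=
  cna * \int[haarc]_(y in Omega) ((u x - u y) * jump_kernel x y).

Definition L2_Omega (f : Kn -> R) : Prop :=
  measurable_fun Omega f /\
  (\int[haarc]_(x in Omega) ((f x ^+ 2)%:E) < +oo)%E.

Definition L1_Omegac (g : Kn -> R) : Prop :=
  haarc.-integrable (~` Omega) (EFin \o g).

(* (K^n x K^n) \ (Omega^c x Omega^c). Integrals over it are for haarc \x haarc
   on the product sigma-algebra, which is not completed again; the integrands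
   are measurable for it as soon as u and v are measurable on Kn. *)
Definition cross : set (Kn * Kn) := ~` ((~` Omega) `*` (~` Omega)).

Definition Hnorm (rho u : Kn -> R) : \bar R :=
  ((\int[haarc]_(x in Omega) ((u x ^+ 2)%:E)
    + \int[haarc]_(x in ~` Omega) (((Num.sqrt `|rho x| * u x) ^+ 2)%:E)
    + \int[haarc \x haarc]_(z in cross)
        ((`|u z.1 - u z.2| ^+ 2 * jump_kernel z.1 z.2)%:E)) `^ 2^-1)%E.

Definition Hspace (rho u : Kn -> R) : Prop :=
  measurable_fun [set: Kn] u /\ (Hnorm rho u < +oo)%E.

Definition weak_solution (f g u : Kn -> R) : Prop :=
  Hspace (cst 0) u /\
  forall v : Kn -> R, Hspace g v ->
    cna / 2 * \int[(haarc \x haarc)%E]_(z in cross)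
      ((u z.1 - u z.2) * (v z.1 - v z.2) * jump_kernel z.1 z.2)
    = \int[haarc]_(x in Omega) (f x * v x)
      + \int[haarc]_(y in ~` Omega) (g y * v y).

End Neumann.

Arguments haarc {R K abs n} mu _.
Arguments Omega {R K abs} q {n} mu N _.
Arguments Nalpha {R K abs} q {n} mu alpha N u x.
Arguments L2_Omega {R K abs} q {n} mu N f.
Arguments L1_Omegac {R K abs} q {n} mu N g.
Arguments Hnorm {R K abs} q {n} mu alpha N rho u.
Arguments Hspace {R K abs} q {n} mu alpha N rho u.
Arguments weak_solution {R K abs} q {n} mu alpha N f g u.

(* Main.v *)
Require Import Defs.
From mathcomp Require Import all_boot all_order all_algebra.
From mathcomp Require Import all_classical all_reals all_analysis.
From mathcomp Require Import measurable_realfun ring lra zify.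
Set Implicit Arguments.
Unset Strict Implicit.
Unset Printing Implicit Defensive.
Import Order.TTheory GRing.Theory Num.Theory.
Import numFieldNormedType.Exports.
Local Open Scope classical_set_scope.
Local Open Scope ring_scope.

(** Both forms of the problem see a function only through its increments
    [u x - u y] with at least one of [x], [y] in the ball [Omega], so the
    natural space is that of functions of finite energy, and the question is
    whether the load [v |-> int_Omega f v + int_(Omega^c) g v] is a bounded
    functional for the energy.

    The geometry enters at one place. The norm is ultrametric and [Omega] is a
    ball around 0, hence for [y] in [Omega] the kernel [k x y] is bounded below
    by [kap x = max (|x|, q^N) ^ -(n + alpha)], which does not depend on [y],
    and it is equal to [kap x] when [x] lies outside [Omega]. Integrating
    [kap x (u x - u y)^2] over [y] in [Omega] and using that the mean is the
    best constant approximation in L2 gives a Poincare inequality on the whole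
    space (lemma [poincare]):
      [mu(Omega) * int kap (u - mean u)^2 <= energy u].

    - Existence. When [int_Omega f + int_(Omega^c) g = 0] the load does not see
      constants, so it is [v |-> int h (v - mean v)], with [h] equal to [f] on
      [Omega] and to [g] outside. By the Poincare inequality it is bounded as
      soon as [int h^2 / kap] is finite. On [Omega] the weight is constant and
      [f] is in L2. Outside, [N_alpha psi x = c kap x int_Omega (psi x - psi y)]
      with [psi] bounded, so that [|g| <= C kap] and [g^2 / kap <= C |g|]
      (lemma [neumann_datum_bound]). The solution is then the
      minimizer of [energy v - 2 * load v] (lemma [quadratic_minimizer]);
      completeness of the energy space, which this requires, is again a
      consequence of the Poincare inequality, along a rapidly convergent
      subsequence, and of Fatou's lemma (lemma [energy_complete]).

    - Necessity and uniqueness. The bound [|g| <= C kap] also makes the weighted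
      space of test functions equal to the energy space (lemma [HspaceE]).
      Thus the constant 1 may be used as a test function, which gives
      the compatibility of [f] and [g], and so may the difference of
      two solutions, which has zero energy and is constant by the Poincare
      inequality.

    What remains is to see that [Omega] has positive finite measure and that
    [k] is measurable for the product sigma-algebra. Both rest on the finiteness
    of the residue field: every ball is covered by finitely many translates of
    any other one (lemma [ball_cover]), so that the measures of two balls are
    comparable, and [K^n] is separable. *)

(** * Minimization of a quadratic functional *)

(** A Riesz representation theorem, for the semi-inner product [b] and
    the linear form [L] on the subspace [S]. The hypothesis [L_bounded] is a form
    of the continuity of [L] that does not mention a norm: it says that
    [b v v - 2 * L v], whose minimizers are the solutions, is bounded below. *)
Section QuadraticMinimizer.
Context {R : realType} {V : lmodType R} (S : set V).
Variables (b : V -> V -> R) (L : V -> R) (C : R).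
Hypothesis S0 : S 0.
Hypothesis S_lin : forall a u v, S u -> S v -> S (a *: u + v).
Hypothesis bC : forall u v, b u v = b v u.
Hypothesis b_lin : forall a u v w, S u -> S v -> S w ->
  b (a *: u + v) w = a * b u w + b v w.
Hypothesis b_ge0 : forall u, S u -> 0 <= b u u.
Hypothesis L_lin : forall a u v, S u -> S v -> L (a *: u + v) = a * L u + L v.
Hypothesis L_bounded : forall v, S v -> 2 * L v - C <= b v v.
Hypothesis b_complete : forall u_ : nat -> V, (forall i, S (u_ i)) ->
  (forall e : R, 0 < e -> exists k, forall i j, (k <= i)%N -> (k <= j)%N ->
     b (u_ i - u_ j) (u_ i - u_ j) < e) ->
  exists2 u, S u & forall e : R, 0 < e -> exists k, forall i, (k <= i)%N ->
     b (u_ i - u) (u_ i - u) <= e.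

Let J v := b v v - 2 * L v.

Let b_expand a u v : S u -> S v ->
  b (a *: u + v) (a *: u + v) = a ^+ 2 * b u u + 2 * a * b u v + b v v.
Proof.
move=> Su Sv; have Sauv := S_lin a Su Sv.
rewrite b_lin// (bC u) (bC v) !b_lin// (bC v u); ring.
Qed.

Let J_expand a u v : S u -> S v ->
  J (a *: u + v) = J v + 2 * a * (b u v - L u) + a ^+ 2 * b u u.
Proof. by move=> Su Sv; rewrite /J b_expand// L_lin//; ring. Qed.

Let S_sub u v : S u -> S v -> S (u - v).
Proof. by move=> Su Sv; rewrite addrC -scaleN1r; exact: S_lin. Qed.

(** A minimizing sequence is Cauchy by the parallelogram identity; the
    variational equation holds approximately along it, and passes to the limit
    by the Cauchy-Schwarz inequality for [b]. *)
Lemma quadratic_minimizer : exists2 u, S u & forall v, S v -> b u v = L v.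
Proof.
pose I := inf (J @` S).
have hasI : has_inf (J @` S).
  split; first by exists (J 0), 0.
  exists (- C) => _ [v Sv <-]; rewrite /J.
  have := L_bounded Sv; lra.
have I_le v : S v -> I <= J v by move=> Sv; apply: ge_inf; [case: hasI|exists v].
have near_inf i : exists v, S v /\ J v < I + i.+1%:R^-1.
  have [_ [v Sv <-] Jv] := inf_adherent (ltac:(rewrite invr_gt0 ltr0n//) :
    0 < i.+1%:R^-1 :> R) hasI.
  by exists v.
pose u_ i := sval (cid (near_inf i)).
have Su i : S (u_ i) by rewrite /u_; case: cid => ? [].
have Ju i : J (u_ i) < I + i.+1%:R^-1 by rewrite /u_; case: cid => ? [].
have inv_small (e : R) : 0 < e ->
    exists k, forall i, (k <= i)%N -> i.+1%:R^-1 < e.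
  move=> e0; exists (Num.truncn e^-1) => i ki.
  rewrite invf_plt ?posrE ?ltr0n//.
  by rewrite (lt_le_trans (truncnS_gt _))// ler_nat ltnS.
have [|u SSu u_cvg] := b_complete Su.
  move=> e e0; have [k kP] := inv_small (e / 4) ltac:(lra).
  exists k => i j ki kj; set w := u_ i - u_ j.
  have Sw : S w by exact: S_sub.
  (* the infimum is compared with the value at the midpoint of [u_ i], [u_ j] *)
  have := I_le _ (S_lin 2^-1 Sw (Su j)); rewrite J_expand//.
  have := J_expand 1 Sw (Su j); rewrite scale1r subrK.
  have := Ju i; have := Ju j; have := kP _ ki; have := kP _ kj.
  set x := b w w; set y := b w (u_ j) - L w.
  have -> : 2^-1 ^+ 2 = 4^-1 :> R by rewrite expr2 -invfM -natrM.
  rewrite expr1n; move: (i.+1%:R^-1) (j.+1%:R^-1) => ri rj; lra.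
exists u => // v Sv.
suff small e : 0 < e -> `|b u v - L v| <= e * (1 + b v v).
  apply/eqP; rewrite -subr_eq0 -normr_eq0 eq_le normr_ge0 andbT.
  apply/ler_addgt0Pr => e e0; rewrite add0r.
  have B0 : 0 < 1 + b v v by have := b_ge0 Sv; lra.
  by have := small (e / (1 + b v v)) ltac:(exact: divr_gt0);
    rewrite divfK ?gt_eqF.
move=> e0; have e20 : 0 < e ^+ 2 by exact: exprn_gt0.
have [k kP] := u_cvg _ e20; have [k' kP'] := inv_small _ e20.
pose i := maxn k k'; set w := u_ i - u.
have Sw : S w by exact: S_sub.
have bw : b w w <= e ^+ 2 by apply: kP; rewrite leq_maxl.
have bwv : b w v = b (u_ i) v - b u v.
  by rewrite /w addrC -scaleN1r b_lin//; ring.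
have Jui : J (u_ i) < I + e ^+ 2.
  by rewrite (lt_trans (Ju i))// ltrD2l kP'// leq_maxr.
(* Perturbing by [e * v] and [- e * v] yields both estimates: positivity of [b]
   for [w + a * v], and near-minimality of [u_ i] for [u_ i + a * v]. *)
have hb a := b_ge0 (S_lin a Sv Sw); have hJ a := I_le _ (S_lin a Sv (Su i)).
have := hb e; have := hb (- e); have := hJ e; have := hJ (- e).
rewrite !b_expand// !J_expand// !sqrrN (bC v w) (bC v) bwv.
set x := b u v; set y := b (u_ i) v; set z := b v v; set l := L v => h1 h2 h3 h4.
have key1 : e * (2 * `|y - l|) <= e * (e * (1 + z)).
  by case: (ger0P (y - l)) => _; move: Jui; nra.
have key2 : e * (2 * `|y - x|) <= e * (e * (1 + z)).
  by case: (ger0P (y - x)) => _; nra.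
move: key1 key2; rewrite !ler_pM2l// => key1 key2.
have : `|x - l| <= `|y - l| + `|y - x|.
  have -> : x - l = (y - l) - (y - x) by ring.
  exact: ler_normB.
move: key1 key2; lra.
Qed.

End QuadraticMinimizer.
(** * Weighted square-integrable functions *)

Section WeightedL2.
Context d (X : measurableType d) (R : realType).
Variables (mu : {measure set X -> \bar R}) (D : set X) (h : X -> R).
Hypotheses (mD : measurable D) (mh : measurable_fun D h).
Hypothesis h_ge0 : forall x, 0 <= h x.
Implicit Types F G : X -> R.

Definition sqint F : \bar R := (\int[mu]_(x in D) (F x ^+ 2 * h x)%:E)%E.

Definition sqfinite F := measurable_fun D F /\ (sqint F < +oo)%E.

Definition dot F G : R := \int[mu]_(x in D) (F x * G x * h x).

Local Lemma sqh_ge0 F x : 0 <= F x ^+ 2 * h x.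
Proof. by rewrite mulr_ge0 ?sqr_ge0. Qed.
Hint Resolve sqh_ge0 : core.

Let measurable_sq F : measurable_fun D F ->
  measurable_fun D (EFin \o (fun x => F x ^+ 2 * h x)).
Proof.
move=> mF; apply/measurable_EFinP; apply: measurable_funM => //.
exact: measurable_funX.
Qed.

Let sq_integrable F : measurable_fun D F -> (sqint F < +oo)%E ->
  mu.-integrable D (fun x => (F x ^+ 2 * h x)%:E).
Proof.
move=> mF F2; apply/integrableP; split; first exact: measurable_sq.
rewrite (eq_integral (fun x => (F x ^+ 2 * h x)%:E))// => x _.
by rewrite gee0_abs ?lee_fin.
Qed.

Lemma dot_integrable F G : sqfinite F -> sqfinite G ->
  mu.-integrable D (fun x => (F x * G x * h x)%:E).
Proof.
move=> [mF F2] [mG G2].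
have iF := sq_integrable mF F2; have iG := sq_integrable mG G2.
apply: (le_integrable mD _ _ (integrableD mD iF iG)).
  apply/measurable_EFinP; apply: measurable_funM => //.
  exact: measurable_funM.
move=> x _ /=; rewrite lee_fin normrM (ger0_norm (h_ge0 x)).
rewrite [leRHS]ger0_norm ?addr_ge0// -mulrDl.
apply: ler_wpM2r => //; rewrite normrM -(real_normK (num_real (F x))).
rewrite -(real_normK (num_real (G x))).
have := sqr_ge0 (`|F x| - `|G x|).
have := normr_ge0 (F x); have := normr_ge0 (G x).
move: (`|F x|) (`|G x|) => a b; nra.
Qed.

Lemma sqint_dot F : sqfinite F -> sqint F = (dot F F)%:E.
Proof.
move=> FF; rewrite /dot /Rintegral fineK; last exact: integrable_fin_num (dot_integrable FF FF).
by apply: eq_integral => x _; rewrite expr2.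
Qed.

Lemma dotC F G : dot F G = dot G F.
Proof. by apply: eq_Rintegral => x _; rewrite (mulrC (F x)). Qed.

Lemma dot_ge0 F : 0 <= dot F F.
Proof.
by apply: Rintegral_ge0 => x _; rewrite mulr_ge0// -expr2 sqr_ge0.
Qed.

Lemma sqfinite_lin a F G : sqfinite F -> sqfinite G ->
  sqfinite (fun x => a * F x + G x).
Proof.
move=> FF GG; have [mF _] := FF; have [mG _] := GG.
have mFG : measurable_fun D (fun x => a * F x + G x).
  by apply: measurable_funD => //; exact: measurable_funM.
split => //.
have iF := integrableZl mD (2 * a ^+ 2) (dot_integrable FF FF).
have iG := integrableZl mD 2 (dot_integrable GG GG).
apply: le_lt_trans (integrable_lty mD (integrableD mD iF iG)).
apply: ge0_le_integral => //.
- by move=> x _; rewrite lee_fin mulr_ge0 ?sqr_ge0.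
- exact: measurable_sq mFG.
- exact: measurable_int (integrableD mD iF iG).
- move=> x _; rewrite -!EFinM -EFinD lee_fin !mulrA -mulrDl.
  apply: ler_wpM2r => //.
  by have := sqr_ge0 (a * F x - G x); nra.
Qed.

Lemma dot_lin a F G H : sqfinite F -> sqfinite G -> sqfinite H ->
  dot (fun x => a * F x + G x) H = a * dot F H + dot G H.
Proof.
move=> FF GG HH; rewrite -RintegralZl//; last exact: dot_integrable.
rewrite -RintegralD//; last 2 first.
- exact: integrableZl (dot_integrable FF HH).
- exact: dot_integrable.
by apply: eq_Rintegral => x _; ring.
Qed.

(** Almost everywhere convergence does not increase a bound on the square
    integrals; the exceptional set is explicit because for functions on a
    product it comes from a null set of the factor. *)
Lemma sqint_fatou (N : set X) (F_ : nat -> X -> R) F (e : \bar R) :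
  measurable N -> mu N = 0 ->
  (forall i, measurable_fun D (F_ i)) -> measurable_fun D F ->
  (forall x, D x -> ~ N x -> F_ i x @[i --> \oo] --> F x) ->
  (forall i, (sqint (F_ i) <= e)%E) -> (sqint F <= e)%E.
Proof.
move=> mN N0 mF_ mF F_F F_e; rewrite /sqint.
have pos G x : D x -> (0 <= (G x ^+ 2 * h x)%:E)%E.
  by rewrite lee_fin.
have mDN : measurable (D `\` N) by exact: measurableD.
rewrite (ge0_negligible_integral mN)//; last 2 first.
- exact: measurable_sq mF.
- exact: pos.
have F_lim x : (D `\` N) x ->
    (F x ^+ 2 * h x)%:E = limn_einf (fun i => (F_ i x ^+ 2 * h x)%:E).
  move=> [Dx Nx]; apply/esym/(cvg_limn_einf_sup _).1.
  apply: cvg_EFin; first by near=> i.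
  by apply: cvgM (cvg_cst _); apply: cvgM; exact: F_F.
rewrite (eq_integral _ _ (fun x xDN => F_lim x (set_mem xDN))).
have mDNF i : measurable_fun (D `\` N) (EFin \o (fun x => F_ i x ^+ 2 * h x)).
  by apply: measurable_funS (measurable_sq (mF_ i)) => //; exact: subDsetl.
apply: le_trans (fatou mu mDN mDNF _) _.
- by move=> i x [Dx _]; exact: (pos (F_ i)).
rewrite limn_einf_lim; apply: lime_le; first exact: is_cvg_einfs.
near=> i; apply: le_trans (F_e i).
apply: le_trans (_ : _ <= \int[mu]_(x in D `\` N) (F_ i x ^+ 2 * h x)%:E)%E _.
  by apply: ereal_inf_lbound; exists i => /=.
apply: ge0_subset_integral => //.
- exact: measurable_sq (mF_ _).
- exact: (pos (F_ i)).
Unshelve. all: by end_near.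
Qed.

End WeightedL2.
(** The key step in the completeness of L2: since the squared distance of
    consecutive terms is at most [8 ^ -i], the sum of the functions
    [4 ^ i (w_ i.+1 - w_ i)^2 h] is integrable, hence finite almost everywhere,
    and where it is finite [|w_ i.+1 - w_ i|] is bounded by a geometric
    sequence of ratio [1/2]. *)
Lemma fast_cauchy_ae_cvg d (X : measurableType d) (R : realType)
    (mu : {measure set X -> \bar R}) (h : X -> R) (w_ : nat -> X -> R) :
  measurable_fun setT h -> (forall x, 0 < h x) ->
  (forall i, measurable_fun setT (w_ i)) ->
  (forall i, (sqint mu setT h (fun x => w_ i.+1 x - w_ i x)%R
              <= ((8 ^+ i)^-1)%:E)%E) ->
  exists w : X -> R, measurable_fun setT w /\
    exists N, [/\ measurable N, mu N = 0 &
      forall x, ~ N x -> w_ i x @[i --> \oo] --> w x].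
Proof.
move=> mh h_gt0 mw w_fast.
pose jump i x := (w_ i.+1 x - w_ i x) ^+ 2 * h x.
have jump_ge0 i x : 0 <= jump i x by rewrite mulr_ge0 ?sqr_ge0// ltW.
pose S x : \bar R := (\sum_(i <oo) (4 ^+ i * jump i x)%:E)%E.
have mjump i : measurable_fun setT (EFin \o jump i).
  apply/measurable_EFinP; apply: measurable_funM => //.
  by apply: measurable_funX; exact: measurable_funB.
have mterm i : measurable_fun setT (fun x => (4 ^+ i * jump i x)%:E : \bar R).
  by apply/measurable_EFinP; apply: measurable_funM => //; exact/measurable_EFinP.
have term_ge0 i x : (0 <= (4 ^+ i * jump i x)%:E)%E.
  by rewrite lee_fin mulr_ge0// exprn_ge0.
have S_int : (\int[mu]_x S x < +oo)%E.
  rewrite integral_nneseries//.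
  apply: (@le_lt_trans _ _ (\sum_(i <oo) (2 / (2 ^ (i + 1))%:R)%:E)%E).
    apply: lee_nneseries => [i _ _|i _]; first exact: integral_ge0.
    under eq_integral do rewrite EFinM.
    rewrite ge0_integralZl_EFin ?exprn_ge0//; first last.
    - exact: mjump.
    - by move=> x _; rewrite lee_fin.
    apply: le_trans (lee_wpmul2l _ (w_fast i)) _; first by rewrite lee_fin exprn_ge0.
    rewrite -EFinM lee_fin addn1 expnS natrM invfM mulrA divff// mul1r.
    have -> : 8 ^+ i = 4 ^+ i * 2 ^+ i :> R by rewrite -exprMn -natrM.
    by rewrite natrX invfM mulrA divff ?mul1r// expf_neq0.
  rewrite [X in (X < _)%E](_ : _ = (2 / 2 ^+ 0)%:E) ?ltry//.
  by apply: cvg_lim => //; exact: cvg_geometric_eseries_half.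
have mS : measurable_fun setT S by exact: ge0_emeasurable_sum.
have S_ge0 x : (0 <= S x)%E by exact: nneseries_ge0.
have iS : mu.-integrable setT S.
  apply/integrableP; split => //.
  by rewrite (eq_integral S)// => x _; rewrite gee0_abs.
have [N [mN N0 SN]] := integrable_ae measurableT iS.
have w_cvg x : ~ N x -> cvgn (w_ ^~ x).
  move=> Nx; have Sx : S x \is a fin_num.
    by apply: contrapT => Sx; apply: Nx; apply: SN => /= /(_ Logic.I).
  pose M := fine (S x); pose c := Num.sqrt (M / h x).
  have M_ge0 : 0 <= M by exact: fine_ge0.
  have jump_le i : `|w_ i.+1 x - w_ i x| <= c * 2^-1 ^+ i.
    have le_M : 4 ^+ i * jump i x <= M.
      rewrite -lee_fin /M fineK//.
      apply: le_trans (nneseries_lim_ge i.+1 (fun n _ _ => term_ge0 n x)).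
      rewrite big_mkord big_ord_recr/= leeDr// sume_ge0//.
    rewrite -ler_sqr ?nnegrE ?mulr_ge0 ?sqrtr_ge0 ?exprn_ge0//.
    rewrite real_normK ?num_real// exprMn sqr_sqrtr; last first.
      by rewrite divr_ge0// ltW.
    rewrite -exprM mulnC exprM (_ : 2^-1 ^+ 2 = 4^-1 :> R); last first.
      by rewrite expr2 -invfM -natrM.
    rewrite exprVn ler_pdivlMr ?exprn_gt0// ler_pdivlMr//.
    by move: le_M; rewrite /jump; lra.
  have : cvgn [normed series (telescope (w_ ^~ x))].
    apply: (@series_le_cvg _ _ (geometric c 2^-1)) => //=.
    - by move=> i; rewrite mulr_ge0 ?sqrtr_ge0 ?exprn_ge0.
    - by apply: is_cvg_geometric_series; rewrite ger0_norm// invf_lt1// ltr1n.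
  move=> /normed_cvg; rewrite telescopeK => cw.
  have -> : w_ ^~ x = (fun n => (w_ n x - w_ 0 x) + w_ 0 x).
    by apply/funext => n; rewrite subrK.
  by apply: is_cvgD => //; exact: is_cvg_cst.
(* Replacing the functions by 0 on [N] makes the sequence converge everywhere, so
   that the limit is measurable. *)
pose w_N i x := w_ i x * \1_(~` N) x.
have w_N_cvg x : cvgn (w_N ^~ x).
  rewrite /w_N; have [Nx|Nx] := pselect (N x).
    rewrite (_ : (fun i => _) = cst 0); first exact: is_cvg_cst.
    by apply/funext => i; rewrite indicE memNset ?mulr0// => /(_ Nx).
  rewrite indicE mem_set//; under eq_fun do rewrite mulr1.
  exact: w_cvg.
exists (fun x => limn (w_N ^~ x)); split.
  apply: (measurable_fun_cvg (h := w_N)) => [i|x _]; last exact: w_N_cvg.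
  apply: measurable_funM => //; apply: measurable_indic; exact: measurableC.
exists N; split => // x Nx; have := w_N_cvg x.
rewrite {1}/w_N indicE mem_set//.
by under eq_fun do rewrite mulr1.
Qed.
(** * The energy space of a dominated kernel *)

(** Young's inequality with weight [s] for a positive quadratic form, where [a],
    [b], [c] are the values [<F,G>], [<G,G>], [<F,F>]: the third hypothesis is
    the positivity of [<F - s G, F - s G>]. *)
Lemma weighted_young (R : realFieldType) (s a b c e : R) : 0 < s ->
  b <= s^-1 * e -> 0 <= - s * (- s * b + a) + (- s * a + c) ->
  2 * a - s^-1 * c <= e.
Proof.
move=> s0 be ab; have r0 : 0 <= s^-1 by rewrite invr_ge0 ltW.
have := mulr_ge0 r0 ab.
have -> : s^-1 * (- s * (- s * b + a) + (- s * a + c))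
    = s * b - 2 * a + s^-1 * c by field; rewrite gt_eqF.
have : s * b <= e by rewrite -ler_pdivlMl.
lra.
Qed.

(** The only link between the kernel [k] and the domain [Om] is [kap_le]: seen
    from any point of [Om], the kernel dominates one and the same weight.
    The diagonal is excluded since there the increments vanish, whatever the
    value of the kernel. *)
Section EnergySpace.
Context d (T : measurableType d) (R : realType).
Variables (m : {sigma_finite_measure set T -> \bar R}) (Om : set T).
Variables (k : T -> T -> R) (kap : T -> R).
Hypotheses (mOm : measurable Om) (Om_gt0 : (0 < m Om)%E).
Hypothesis Om_fin : (m Om < +oo)%E.
Hypothesis mk : measurable_fun setT (fun z : T * T => k z.1 z.2).
Hypothesis k_ge0 : forall x y, 0 <= k x y.
Hypothesis mkap : measurable_fun setT kap.
Hypothesis kap_gt0 : forall x, 0 < kap x.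
Hypothesis kap_le : forall x y, Om y -> x <> y -> kap x <= k x y.

Let X : set (T * T) := ~` ((~` Om) `*` (~` Om)).
Let kk (z : T * T) := k z.1 z.2.
Let s := fine (m Om).

Definition increment (u : T -> R) (z : T * T) := u z.1 - u z.2.

Definition energy u : \bar R := sqint (m \x m)%E X kk (increment u).

Definition energy_dot u v : R := dot (m \x m)%E X kk (increment u) (increment v).

Definition energy_space : set (T -> R) := [set u |
  [/\ measurable_fun setT u, sqfinite m Om (fun=> 1) u
    & sqfinite (m \x m)%E X kk (increment u)]].

Definition mean (u : T -> R) := s^-1 * \int[m]_(y in Om) u y.

Let mX : measurable X.
Proof. by apply: measurableC; apply: measurableX; exact: measurableC. Qed.

Let mkX : measurable_fun X kk.
Proof. exact: measurable_funTS. Qed.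

Let kk_ge0 z : 0 <= kk z.
Proof. exact: k_ge0. Qed.

Let kap_ge0 x : 0 <= kap x.
Proof. exact: ltW. Qed.

Let s_gt0 : 0 < s.
Proof. by rewrite /s fine_gt0// Om_gt0. Qed.

Let sE : (m : {measure set T -> \bar R}) Om = s%:E.
Proof. by rewrite /s fineK// ge0_fin_numE. Qed.

Let m1 : measurable_fun Om (fun=> 1 : R).
Proof. exact: measurable_cst. Qed.

Lemma measurable_increment u : measurable_fun setT u ->
  measurable_fun setT (increment u).
Proof.
by move=> mu; apply: measurable_funB; exact: measurableT_comp.
Qed.

Let sqfinite_cst c : sqfinite m Om (fun=> 1) (fun=> c).
Proof.
split; first exact: measurable_cst.
rewrite /sqint; under eq_integral do rewrite mulr1.
by rewrite integral_cst// sE -EFinM ltry.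
Qed.

Let Om_integrable u : sqfinite m Om (fun=> 1) u -> m.-integrable Om (EFin \o u).
Proof.
move=> u2; apply: eq_integrable (dot_integrable mOm m1 (fun=> ler01) u2 (sqfinite_cst 1)) => //.
by move=> x _ /=; rewrite !mulr1.
Qed.

(** The mean is the closest constant in L2: the square of [a - u] minus its mean
    has nonnegative integral. *)
Let dist_mean_le u a : sqfinite m Om (fun=> 1) u ->
  ((s * (a - mean u) ^+ 2)%:E <= \int[m]_(y in Om) ((a - u y) ^+ 2)%:E)%E.
Proof.
move=> u2; pose F y := (-1) * u y + a; set t := a - mean u.
have pos1 (x : T) : 0 <= (1 : R) by exact: ler01.
have F2 : sqfinite m Om (fun=> 1) F by exact: sqfinite_lin.
have -> : (\int[m]_(y in Om) ((a - u y) ^+ 2)%:E)%E = sqint m Om (fun=> 1) F.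
  by apply: eq_integral => y _; rewrite mulr1 /F mulN1r addrC.
rewrite sqint_dot// lee_fin.
have dot11 c : dot m Om (fun=> 1) (fun=> c) (fun=> 1) = c * s.
  rewrite /dot; under eq_Rintegral do rewrite !mulr1.
  by rewrite Rintegral_cst.
have dotu1 : dot m Om (fun=> 1) u (fun=> 1) = s * mean u.
  rewrite /mean mulrA divff ?gt_eqF// mul1r.
  by apply: eq_Rintegral => x _; rewrite !mulr1.
have dotF1 : dot m Om (fun=> 1) F (fun=> 1) = s * t.
  by rewrite dot_lin// dotu1 dot11 /t; ring.
pose one : T -> R := fun=> 1; have one2 := sqfinite_cst 1 : sqfinite m Om _ one.
have := dot_ge0 m Om pos1 (fun y => (- t) * one y + F y).
have G2 := sqfinite_lin mOm m1 pos1 (- t) one2 F2.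
rewrite (dot_lin mOm m1 pos1 _ one2 F2 G2).
rewrite !(dotC _ _ _ _ (fun y => (- t) * one y + F y)).
rewrite (dot_lin mOm m1 pos1 _ one2 F2 one2) (dot_lin mOm m1 pos1 _ one2 F2 F2).
rewrite (dotC _ _ _ one F) dotF1 (dot11 1) -subr_ge0 => /le_trans; apply.
by rewrite le_eqVlt; apply/orP; left; apply/eqP; ring.
Qed.

(** Tonelli's theorem on the strip [T x Om], the part of the domain of the energy
    that the Poincare inequality uses. *)
Let integral_strip (f : T * T -> \bar R) : measurable_fun setT f ->
  (forall z, (0 <= f z)%E) ->
  (\int[m \x m]_(z in setT `*` Om) f z
   = \int[m]_x \int[m]_(y in Om) f (x, y))%E /\
  measurable_fun setT (fun x => \int[m]_(y in Om) f (x, y))%E.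
Proof.
move=> mf f0.
have mS : measurable (setT `*` Om : set (T * T)) by exact: measurableX.
have mfS : measurable_fun setT (f \_ (setT `*` Om)).
  by apply/(measurable_restrictT _ mS); exact: measurable_funTS.
have fS0 z : (0 <= (f \_ (setT `*` Om)) z)%E by rewrite patchE; case: ifP.
have sec x : (\int[m]_(y in Om) f (x, y)
    = \int[m]_y (f \_ (setT `*` Om)) (x, y))%E.
  rewrite integral_mkcond; apply: eq_integral => y _.
  by rewrite !patchE in_setX in_setT.
split; last first.
  by under eq_fun do rewrite sec; exact: measurable_fun_fubini_tonelli_F.
rewrite integral_mkcond fubini_tonelli1//.
by apply: eq_integral => x _; rewrite sec.
Qed.

(** By [dist_mean_le], [s * kap x * (u x - mean u)^2] is at most the integral
    over [y] in [Om] of [kap x * (u x - u y)^2], and [kap x <= k x y] there. *)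
Lemma poincare u : measurable_fun setT u -> sqfinite m Om (fun=> 1) u ->
  (s%:E * sqint m setT kap (fun x => u x - mean u)%R <= energy u)%E.
Proof.
move=> mu u2; pose f (z : T * T) := (increment u z ^+ 2 * kk z)%:E.
have mf : measurable_fun setT f.
  apply/measurable_EFinP; apply: measurable_funM => //.
  by apply: measurable_funX; exact: measurable_increment.
have f0 z : (0 <= f z)%E by rewrite lee_fin mulr_ge0 ?sqr_ge0.
have [fE mF] := integral_strip mf f0.
have mg : measurable_fun setT (fun x => ((u x - mean u) ^+ 2 * kap x)%:E : \bar R).
  apply/measurable_EFinP; apply: measurable_funM => //.
  by apply: measurable_funX; exact: measurable_funB.
have g0 x : (0 <= ((u x - mean u) ^+ 2 * kap x)%:E)%E.
  by rewrite lee_fin mulr_ge0 ?sqr_ge0.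
apply: (@le_trans _ _ (\int[m \x m]_(z in setT `*` Om) f z)%E); last first.
  apply: ge0_subset_integral => //; first exact: measurableX.
  - exact: measurable_funTS.
  - by move=> [x y] [_ Oy] [].
rewrite fE /sqint -ge0_integralZl_EFin//; last exact: ltW.
apply: ge0_le_integral => //.
- by move=> x _; rewrite mule_ge0// lee_fin ltW.
- exact: measurable_funeM.
move=> x _; rewrite -EFinM mulrA mulrC EFinM.
apply: le_trans (lee_wpmul2l _ (dist_mean_le (u x) u2)) _.
  by rewrite lee_fin.
have mu1 : measurable_fun Om (fun y => u x - u y).
  by apply: measurable_funB => //; exact: measurable_funTS.
have mu2 : measurable_fun Om (fun y => ((u x - u y) ^+ 2)%:E : \bar R).
  by apply/measurable_EFinP; exact: measurable_funX.
rewrite -ge0_integralZl_EFin//; last by move=> y _; rewrite lee_fin sqr_ge0.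
apply: ge0_le_integral => //.
- by move=> y _; rewrite -EFinM lee_fin mulr_ge0 ?sqr_ge0.
- exact: measurable_funeM.
- apply: measurable_funTS; exact: measurableT_comp.
move=> y Oy; rewrite -EFinM lee_fin /increment/kk/= mulrC.
have [->|/eqP xy] := eqVneq x y; first by rewrite subrr expr0n/= !mul0r.
by apply: ler_wpM2l; [exact: sqr_ge0|exact: kap_le].
Qed.

Let increment_lin a u v : increment (a *: u + v)
  = (fun z => a * increment u z + increment v z).
Proof. by apply/funext => z; rewrite /increment !fctE/= /GRing.scale/=; ring. Qed.

Let pos1 (x : T) : 0 <= (1 : R). Proof. exact: ler01. Qed.

Lemma energy_space_cst c : energy_space (fun=> c).
Proof.
split; [exact: measurable_cst|exact: sqfinite_cst|].
have -> : increment (fun=> c) = fun=> 0 by apply/funext => z; rewrite /increment subrr.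
split; first exact: measurable_cst.
rewrite /sqint; under eq_integral do rewrite expr0n mul0r.
by rewrite integral0.
Qed.

Lemma energy_space_lin a u v :
  energy_space u -> energy_space v -> energy_space (a *: u + v).
Proof.
move=> [mu u2 Eu] [mv v2 Ev]; split.
- by apply: measurable_funD => //; exact: measurable_funM.
- exact: (sqfinite_lin mOm m1 pos1 a u2 v2).
- by rewrite increment_lin; exact: sqfinite_lin.
Qed.

Let energy_space_sub u v :
  energy_space u -> energy_space v -> energy_space (u - v).
Proof. by move=> Eu Ev; rewrite addrC -scaleN1r; exact: energy_space_lin. Qed.

Lemma energy_dot_lin a u v w : energy_space u -> energy_space v ->
  energy_space w -> energy_dot (a *: u + v) w = a * energy_dot u w + energy_dot v w.
Proof.
move=> [_ _ Eu] [_ _ Ev] [_ _ Ew].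
by rewrite /energy_dot increment_lin dot_lin.
Qed.

Lemma energyE u : energy_space u -> energy u = (energy_dot u u)%:E.
Proof. by move=> [_ _ Eu]; exact: sqint_dot. Qed.

Let mean_lin a u v : energy_space u -> energy_space v ->
  mean (a *: u + v) = a * mean u + mean v.
Proof.
move=> [_ /Om_integrable u1 _] [_ /Om_integrable v1 _].
rewrite /mean mulrCA -mulrDr; congr (_ * _).
rewrite -RintegralZl// -RintegralD//.
exact: (integrableZl mOm a u1).
Qed.

Let mean_sub u v : energy_space u -> energy_space v ->
  mean (u - v) = mean u - mean v.
Proof.
by move=> Eu Ev; rewrite addrC -scaleN1r mean_lin// mulN1r addrC.
Qed.

Let sqint_mean_le u : energy_space u ->
  (sqint m setT kap (fun x => u x - mean u)%R <= (s^-1 * energy_dot u u)%:E)%E.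
Proof.
move=> Eu; have [mu u2 _] := Eu.
by rewrite EFinM lee_pdivlMl// -energyE//; exact: poincare.
Qed.

Lemma sqfinite_sub_mean u : energy_space u ->
  sqfinite m setT kap (fun x => u x - mean u).
Proof.
move=> Eu; have [mu _ _] := Eu; split; first exact: measurable_funB.
by apply: le_lt_trans (sqint_mean_le Eu) _; rewrite ltry.
Qed.

Lemma energy_constant u : energy_space u -> energy_dot u u = 0 ->
  {ae m, forall x, u x = mean u}.
Proof.
move=> Eu E0; have [mu _ _] := Eu.
have := sqint_mean_le Eu; rewrite E0 mulr0 => sq_le0.
have mG : measurable_fun setT (EFin \o (fun x => (u x - mean u) ^+ 2 * kap x)).
  apply/measurable_EFinP; apply: measurable_funM => //.
  by apply: measurable_funX; exact: measurable_funB.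
have /(ae_eq_integral_abs m measurableT mG) :
    (\int[m]_x `|((u x - mean u) ^+ 2 * kap x)%:E| = 0)%E.
  apply/eqP; rewrite eq_le integral_ge0 ?andbT//.
  apply: le_trans sq_le0; rewrite le_eqVlt; apply/orP; left; apply/eqP.
  by apply: eq_integral => x _; rewrite gee0_abs// lee_fin mulr_ge0 ?sqr_ge0.
apply: filterS => x /(_ Logic.I)/= [] /eqP.
by rewrite mulf_eq0 (gt_eqF (kap_gt0 x)) orbF sqrf_eq0 subr_eq0 => /eqP.
Qed.

(** [u^2] is at most [2 (u - mean u)^2 + 2 (mean u)^2]; against the weight [|g|],
    the first term is controlled by [C * kap] and the Poincare inequality, the
    second one by the integrability of [g]. *)
Lemma sqint_dominated_weight u (D : set T) (g : T -> R) (C : R) :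
  energy_space u -> measurable D -> m.-integrable D (EFin \o g) -> 0 <= C ->
  {ae m, forall x, D x -> `|g x| <= C * kap x} ->
  (\int[m]_(x in D) (((Num.sqrt `|g x| * u x) ^+ 2)%:E) < +oo)%E.
Proof.
move=> Eu mD ig C_ge0 g_le; have [mu _ _] := Eu; set c := mean u.
have u2 := sqfinite_sub_mean Eu.
have mg : measurable_fun D g by have /measurable_int/measurable_EFinP := ig.
have iu : m.-integrable D (fun x => ((u x - c) * (u x - c) * kap x)%:E).
  by apply: integrableS (dot_integrable measurableT mkap kap_ge0 u2 u2).
have iub := integrableD mD (integrableZl mD (2 * C) iu)
  (integrableZl mD (2 * c ^+ 2) (integrable_norm ig)).
apply: (le_lt_trans _ (integrable_lty mD iub)).
rewrite [leLHS](eq_integral (fun x => (`|g x| * u x ^+ 2)%:E)); last first.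
  by move=> x _; rewrite exprMn sqr_sqrtr.
have mu1 : measurable_fun D u by exact: measurable_funTS.
apply: ae_ge0_le_integral => //.
- by move=> x _; rewrite lee_fin mulr_ge0 ?sqr_ge0.
- apply/measurable_EFinP; apply: measurable_funM; first exact: measurableT_comp.
  exact: measurable_funX.
- move=> x _; rewrite -!EFinM -EFinD lee_fin -expr2; apply: addr_ge0.
    by apply: mulr_ge0; [exact: mulr_ge0|rewrite mulr_ge0 ?sqr_ge0].
  by apply: mulr_ge0; [exact: mulr_ge0 (ler0n _ 2) (sqr_ge0 c)|exact: normr_ge0].
- exact: measurable_int iub.
apply: filterS g_le => x gx Dx; rewrite -!EFinM -EFinD lee_fin.
have := gx Dx; have := normr_ge0 (g x); rewrite /=; move: (`|g x|) => G G0 GC.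
have u2le : u x ^+ 2 <= 2 * ((u x - c) * (u x - c)) + 2 * c ^+ 2.
  by rewrite -subr_ge0 (_ : _ - _ = (u x - 2 * c) ^+ 2) ?sqr_ge0//; ring.
apply: le_trans (ler_wpM2l G0 u2le) _; rewrite mulrDr; apply: lerD.
  rewrite mulrCA (_ : 2 * C * _ = 2 * (C * kap x * ((u x - c) * (u x - c)))).
    by rewrite ler_pM2l// ler_wpM2r// -expr2 sqr_ge0.
  by ring.
by rewrite mulrC.
Qed.

Section Complete.
Variable c0 : R.
Hypotheses (c0_gt0 : 0 < c0) (c0_le : forall x, Om x -> c0 <= kap x).

(** A positive lower bound of [kap] on [Om] turns the weighted estimates into
    estimates in [L2(Om)]. *)
Let sqint_Om_le G : measurable_fun setT G ->
  (sqint m Om (fun=> 1%R) G <= c0^-1%:E * sqint m setT kap G)%E.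
Proof.
move=> mG; have mG2 : measurable_fun setT (fun x => (G x ^+ 2)%:E : \bar R).
  by apply/measurable_EFinP; exact: measurable_funX.
have mGk : measurable_fun setT (fun x => (G x ^+ 2 * kap x)%:E : \bar R).
  apply/measurable_EFinP; apply: measurable_funM => //; exact: measurable_funX.
rewrite lee_pdivlMl// /sqint; under eq_integral do rewrite mulr1.
rewrite -ge0_integralZl_EFin//; last 3 first.
- by move=> x _; rewrite lee_fin sqr_ge0.
- exact: measurable_funTS.
- exact: ltW.
apply: (@le_trans _ _ (\int[m]_(x in Om) (G x ^+ 2 * kap x)%:E)%E).
  apply: ge0_le_integral => //.
  - by move=> x _; rewrite -EFinM lee_fin mulr_ge0 ?sqr_ge0// ltW.
  - by apply: measurable_funTS; exact: measurable_funeM.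
  - exact: measurable_funTS.
  - by move=> x Ox; rewrite -EFinM lee_fin mulrC ler_wpM2l ?sqr_ge0// c0_le.
apply: ge0_subset_integral => // x _; by rewrite lee_fin mulr_ge0 ?sqr_ge0.
Qed.

(** By the Poincare inequality the functions [u_ i - mean (u_ i)] form a Cauchy
    sequence for the weight [kap]. A fast subsequence of it converges almost
    everywhere to some [u], and Fatou's lemma bounds the energy of [u_ i - u];
    subtracting the means has no effect on the energy. *)
Lemma energy_complete (u_ : nat -> T -> R) : (forall i, energy_space (u_ i)) ->
  (forall e : R, 0 < e -> exists n, forall i j, (n <= i)%N -> (n <= j)%N ->
     energy_dot (u_ i - u_ j) (u_ i - u_ j) < e) ->
  exists2 u, energy_space u & forall e : R, 0 < e -> exists n, forall i,
     (n <= i)%N -> energy_dot (u_ i - u) (u_ i - u) <= e.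
Proof.
move=> Eu cauchy; have mu i : measurable_fun setT (u_ i) by case: (Eu i).
have eps0 i : 0 < s / 8 ^+ i by rewrite divr_gt0// exprn_gt0.
pose psi i := sval (cid (cauchy _ (eps0 i))).
have psiP i a b : (psi i <= a)%N -> (psi i <= b)%N ->
    energy_dot (u_ a - u_ b) (u_ a - u_ b) < s / 8 ^+ i.
  by rewrite /psi; case: cid => l /= + la lb; apply.
(* [psi i <= phi i] makes the subsequence fast, [i <= phi i] makes it go to
   infinity. *)
pose phi i := maxn i (\max_(j < i.+1) psi j).
have phi_id i : (i <= phi i)%N by exact: leq_maxl.
have phi_psi i j : (j <= i)%N -> (psi j <= phi i)%N.
  rewrite -ltnS => ji; apply: leq_trans (leq_maxr _ _).
  exact: (@leq_bigmax_cond _ predT (fun l : 'I_i.+1 => psi l) (Ordinal ji)).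
pose w i x := u_ (phi i) x - mean (u_ (phi i)).
have mw i : measurable_fun setT (w i) by exact: measurable_funB.
have w_sub i j : (sqint m setT kap (fun x => w i x - w j x)%R <=
    (s^-1 * energy_dot (u_ (phi i) - u_ (phi j)) (u_ (phi i) - u_ (phi j)))%:E)%E.
  apply: le_trans (sqint_mean_le (energy_space_sub (Eu _) (Eu _))).
  rewrite le_eqVlt; apply/orP; left; apply/eqP; apply: eq_integral => x _.
  by rewrite mean_sub// /w !fctE; congr (_ ^+ 2 * _)%:E; ring.
have w_fast i : (sqint m setT kap (fun x => w i.+1 x - w i x)%R <=
    ((8 ^+ i)^-1)%:E)%E.
  apply: le_trans (w_sub _ _) _; rewrite lee_fin ler_pdivrMl//.
  by apply/ltW/psiP; exact: phi_psi.
have [u [mu_u [N [mN N0 w_u]]]] := fast_cauchy_ae_cvg mkap kap_gt0 mw w_fast.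
(* the increments converge away from this null set *)
pose N2 : set (T * T) := (N `*` setT) `|` (setT `*` N).
have mN2 : measurable N2 by apply: measurableU; exact: measurableX.
have N20 : (m \x m)%E N2 = 0%E.
  have z1 : (m \x m)%E (N `*` setT) = 0%E by rewrite product_measure1E// N0 mul0e.
  have z2 : (m \x m)%E (setT `*` N) = 0%E by rewrite product_measure1E// N0 mule0.
  exact: etrans (measureU0 (measurableX mN measurableT) (measurableX measurableT mN) z2) z1.
have energy_le e : 0 < e -> exists n, forall i, (n <= i)%N ->
    (energy (u_ i - u)%R <= e%:E)%E.
  move=> e0; have [n kP] := cauchy _ e0; exists n => i ki.
  have mdiff (v : T -> R) : measurable_fun setT v ->
      measurable_fun X (increment (u_ i - v)).
    move=> mv; apply: measurable_funTS; apply: measurable_increment.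
    exact: measurable_funB.
  apply: (@sqint_fatou _ _ _ _ _ _ mX mkX kk_ge0 N2
    ( fun j => increment (u_ i - u_ (phi (j + n))))) => //.
  - by move=> j; exact: mdiff.
  - exact: mdiff.
  - move=> [x y] _ /not_orP[/= xN yN].
    have cvg_sub : (w (j + n) x - w (j + n) y) @[j --> \oo] --> u x - u y.
      apply: cvgB; rewrite (cvg_shiftn n (w ^~ _)); apply: w_u.
        by move=> Nx; apply: xN.
      by move=> Ny; apply: yN.
    have -> : increment (u_ i - u) (x, y)
        = (u_ i x - u_ i y) - (u x - u y) by rewrite /increment/= !fctE; ring.
    have -> : (fun j => increment (u_ i - u_ (phi (j + n))) (x, y))
        = (fun j => (u_ i x - u_ i y) - (w (j + n) x - w (j + n) y)).
      by apply/funext => j; rewrite /increment /w/= !fctE; ring.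
    by apply: cvgB => //; exact: cvg_cst.
  - move=> j; rewrite -/(energy _) energyE; last exact: energy_space_sub.
    rewrite lee_fin ltW// kP//; apply: leq_trans (phi_id _).
    exact: leq_addl.
have Eu_u : energy_space u.
  split=> //.
    have [n kP] := cauchy _ ltr01.
    have wku : (sqint m setT kap (fun x => w n x - u x)%R <= (s^-1 * 1)%:E)%E.
      apply: (@sqint_fatou _ _ _ _ _ _ measurableT mkap kap_ge0 N
        ( fun j x => w n x - w (j + n)%N x)) => //.
      - by move=> j; exact: measurable_funB.
      - exact: measurable_funB.
      - move=> x _ Nx; apply: cvgB; first exact: cvg_cst.
        by rewrite (cvg_shiftn n (w ^~ x)); exact: w_u.
      - move=> j; apply: le_trans (w_sub _ _) _; rewrite lee_fin.
        rewrite ler_wpM2l ?invr_ge0 ?ltW// kP//.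
        by apply: leq_trans (phi_id _); rewrite leq_addl.
    have wk2 : sqfinite m Om (fun=> 1) (w n).
      have [_ uk2 _] := Eu (phi n).
      have := sqfinite_lin mOm m1 pos1 (- mean (u_ (phi n))) (sqfinite_cst 1) uk2.
      congr sqfinite; apply/funext => x; rewrite /w; ring.
    have wku2 : sqfinite m Om (fun=> 1) (fun x => w n x - u x).
      split; first by apply: measurable_funTS; exact: measurable_funB.
      apply: le_lt_trans (sqint_Om_le (measurable_funB (mw n) mu_u)) _.
      apply: le_lt_trans (lee_wpmul2l _ wku) _; last by rewrite -EFinM ltry.
      by rewrite lee_fin invr_ge0 ltW.
    have := sqfinite_lin mOm m1 pos1 (-1) wku2 wk2.
    congr sqfinite; apply/funext => x; ring.
  have [n kP] := energy_le _ ltr01.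
  have dk : sqfinite (m \x m)%E X kk (increment (u_ n - u)).
    split; last by apply: le_lt_trans (kP n (leqnn n)) _; rewrite ltry.
    apply: measurable_funTS; apply: measurable_increment.
    exact: measurable_funB.
  have [_ _ uk] := Eu n.
  have := sqfinite_lin mX mkX kk_ge0 (-1) dk uk.
  by congr sqfinite; apply/funext => z; rewrite /increment !fctE; ring.
exists u => // e e0; have [n kP] := energy_le _ e0; exists n => i ki.
rewrite -lee_fin -energyE ?kP//; exact: energy_space_sub.
Qed.

End Complete.

(** Loads of the form [v |-> int h v]. Finiteness of [int h^2 / kap] is written
    as square-integrability of [h / kap] for the weight [kap], so that
    [h * (v - mean v)] is a product of two square-integrable functions. *)
Section Riesz.
Variable h : T -> R.
Hypotheses (h_int : m.-integrable setT (EFin \o h)).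
Hypothesis h_sq : sqfinite m setT kap (fun x => h x / kap x).

Let F x := h x / kap x.

Let load_split v x : F x * (v x - mean v) * kap x = h x * v x - h x * mean v.
Proof. by rewrite /F mulrAC divfK ?gt_eqF// mulrBr. Qed.

Let h_cst_int c : m.-integrable setT (fun x => (h x * c)%:E).
Proof. by have := integrableZr measurableT c h_int; apply: eq_integrable. Qed.

Lemma load_integrable v : energy_space v ->
  m.-integrable setT (fun x => (h x * v x)%:E).
Proof.
move=> Ev; have ihv := dot_integrable measurableT mkap kap_ge0 h_sq (sqfinite_sub_mean Ev).
apply: eq_integrable (integrableD measurableT ihv (h_cst_int (mean v))) => // x _.
by rewrite -EFinD -/(F x) load_split subrK.
Qed.

Hypothesis h_mean0 : \int[m]_x h x = 0.

(** A density of zero integral does not see the mean of [v]. *)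
Let loadE v : energy_space v ->
  dot m setT kap F (fun x => v x - mean v) = \int[m]_x (h x * v x).
Proof.
move=> Ev; rewrite /dot; under eq_Rintegral do rewrite load_split.
rewrite RintegralB//; [|exact: load_integrable|exact: h_cst_int].
by rewrite RintegralZr// h_mean0 mul0r subr0.
Qed.

Variable c0 : R.
Hypotheses (c0_gt0 : 0 < c0) (c0_le : forall x, Om x -> c0 <= kap x).

(** The load is bounded for the energy by Young's inequality, with the Poincare
    inequality for the term [s * kap * (v - mean v)^2]. *)
Lemma energy_riesz :
  exists2 u, energy_space u & forall v, energy_space v ->
    energy_dot u v = \int[m]_x (h x * v x).
Proof.
pose L v := dot m setT kap F (fun x => v x - mean v).
have [] := @quadratic_minimizer _ _ energy_space energy_dot L
  (s^-1 * dot m setT kap F F).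
- exact: energy_space_cst.
- exact: energy_space_lin.
- by move=> u v; exact: dotC.
- exact: energy_dot_lin.
- by move=> u _; exact: dot_ge0.
- move=> a u v Eu Ev; rewrite /L !(dotC _ _ _ F) mean_lin//.
  rewrite -dot_lin//; [|exact: sqfinite_sub_mean..].
  by congr dot; apply/funext => x; rewrite !fctE /GRing.scale/=; ring.
- move=> v Ev; set G := fun x => v x - mean v.
  have G2 : sqfinite m setT kap G by exact: sqfinite_sub_mean.
  have := dot_ge0 m setT kap_ge0 (fun x => (- s) * G x + F x).
  have := sqint_mean_le Ev; rewrite sqint_dot// lee_fin.
  have H2 := sqfinite_lin measurableT mkap kap_ge0 (- s) G2 h_sq.
  rewrite (dot_lin measurableT mkap kap_ge0 _ G2 h_sq H2).
  rewrite !(dotC _ _ _ _ (fun x => - s * G x + F x)).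
  rewrite (dot_lin measurableT mkap kap_ge0 _ G2 h_sq G2).
  rewrite (dot_lin measurableT mkap kap_ge0 _ G2 h_sq h_sq).
  rewrite (dotC _ _ _ G F) /L -/G.
  move: (dot _ _ _ F G) (dot _ _ _ G G) (dot _ _ _ F F) (energy_dot v v).
  by move=> fg gg ff e; exact: weighted_young.
- exact: (energy_complete c0_gt0 c0_le).
by move=> u Eu uL; exists u => // v Ev; rewrite uL//; exact: loadE.
Qed.

End Riesz.

(** The density [h] glues the data: [f] inside [Om], [g] outside. *)
Section NeumannData.
Variables (f g : T -> R) (C c0 : R).
Hypothesis mf : measurable_fun Om f.
Hypothesis f_sq : (\int[m]_(x in Om) ((f x ^+ 2)%:E) < +oo)%E.
Hypothesis g_int : m.-integrable (~` Om) (EFin \o g).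
Hypotheses (C_ge0 : 0 <= C) (c0_gt0 : 0 < c0).
Hypothesis g_le : {ae m, forall x, (~` Om) x -> `|g x| <= C * kap x}.
Hypothesis c0_le : forall x, Om x -> c0 <= kap x.

Let f2 : sqfinite m Om (fun=> 1) f.
Proof.
split=> //; apply: le_lt_trans f_sq; rewrite le_eqVlt; apply/orP; left.
by apply/eqP; apply: eq_integral => x _; rewrite mulr1.
Qed.

Let mOmc : measurable (~` Om). Proof. exact: measurableC. Qed.

Let h x := (f \_ Om) x + (g \_ (~` Om)) x.

Let hf x : Om x -> h x = f x.
Proof. by move=> Ox; rewrite /h !patchE mem_set// memNset ?addr0// => /(_ Ox). Qed.

Let hg x : (~` Om) x -> h x = g x.
Proof. by move=> Ox; rewrite /h !patchE memNset// mem_set// add0r. Qed.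

Let h_int : m.-integrable setT (EFin \o h).
Proof.
have fi : m.-integrable setT (EFin \o (f \_ Om)).
  by rewrite -restrict_EFin; exact: ((integrable_mkcond _ mOm).1 (Om_integrable f2)).
have gi : m.-integrable setT (EFin \o (g \_ (~` Om))).
  by rewrite -restrict_EFin; exact: ((integrable_mkcond _ mOmc).1 g_int).
by apply: eq_integrable (integrableD measurableT fi gi).
Qed.

Let h_split F : m.-integrable setT (EFin \o F) ->
  \int[m]_x F x = \int[m]_(x in Om) F x + \int[m]_(x in ~` Om) F x.
Proof.
move=> iF; rewrite -Rintegral_setU//; first by rewrite setUv.
  by rewrite setUv.
by apply/disj_set2P; rewrite setICr.
Qed.

(** Inside, [h^2 / kap <= f^2 / c0]; outside, [h^2 / kap <= C * |g|]
    almost everywhere. *)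
Let h_sq : sqfinite m setT kap (fun x => h x / kap x).
Proof.
have mh : measurable_fun setT h by exact/measurable_EFinP/(measurable_int _ h_int).
have mkV : measurable_fun setT (fun x => (kap x)^-1).
  rewrite (_ : (fun x => (kap x)^-1) = (fun x => kap x `^ (-1))).
    exact: (measurableT_comp (measurable_powR (-1))).
  by apply/funext => x; rewrite powR_inv1.
have mq : measurable_fun setT (fun x => h x / kap x) by exact: measurable_funM.
split=> //.
have fi : m.-integrable setT (EFin \o ((fun x => f x * f x * 1) \_ Om)).
  rewrite -restrict_EFin; apply: (integrable_mkcond _ mOm).1.
  exact: (dot_integrable mOm m1 pos1 f2 f2).
have gi : m.-integrable setT (EFin \o ((fun x => `|g x|) \_ (~` Om))).
  rewrite -restrict_EFin; apply: (integrable_mkcond _ mOmc).1.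
  exact: integrable_norm.
have iB := integrableD measurableT (integrableZl measurableT c0^-1 fi)
  (integrableZl measurableT C gi).
apply: (le_lt_trans _ (integrable_lty measurableT iB)).
have sqE x : (h x / kap x) ^+ 2 * kap x = h x ^+ 2 / kap x.
  by field; rewrite gt_eqF.
apply: ae_ge0_le_integral => //.
- by move=> x _; rewrite lee_fin mulr_ge0 ?sqr_ge0.
- by apply/measurable_EFinP; apply: measurable_funM => //; exact: measurable_funX.
- move=> x _; rewrite /= -!EFinM -EFinD lee_fin !patchE.
  have ci : 0 <= c0^-1 by rewrite invr_ge0 ltW.
  apply: addr_ge0; apply: mulr_ge0 => //; case: ifP => // _.
  by rewrite mulr1 -expr2 sqr_ge0.
- exact: measurable_int iB.
apply: filterS g_le => x gx _; rewrite /= -!EFinM -EFinD lee_fin sqE.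
have [Ox|Ox] := pselect (Om x).
  rewrite hf// !patchE mem_set// memNset ?mulr0 ?addr0; last by move=> /(_ Ox).
  rewrite mulr1 -expr2 mulrC ler_wpM2r ?sqr_ge0// lef_pV2 ?posrE//.
  exact: c0_le.
rewrite hg// !patchE memNset// mem_set// mulr0 add0r ler_pdivrMr//=.
rewrite -(real_normK (num_real (g x))) expr2 mulrAC.
by apply: ler_wpM2r => //; exact: gx.
Qed.

Lemma energy_neumann :
  \int[m]_(x in Om) f x = - (\int[m]_(x in ~` Om) g x) ->
  exists2 u, energy_space u & forall v, energy_space v -> energy_dot u v =
    \int[m]_(x in Om) (f x * v x) + \int[m]_(x in ~` Om) (g x * v x).
Proof.
move=> fg; have eqf v : \int[m]_(x in Om) (h x * v x) = \int[m]_(x in Om) (f x * v x).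
  by apply: eq_Rintegral => x /set_mem Ox; rewrite hf.
have eqg v : \int[m]_(x in ~` Om) (h x * v x) = \int[m]_(x in ~` Om) (g x * v x).
  by apply: eq_Rintegral => x /set_mem Ox; rewrite hg.
have h0 : \int[m]_x h x = 0.
  rewrite h_split//.
  rewrite (@eq_Rintegral _ _ _ _ Om f h); last by move=> x /set_mem; exact: hf.
  rewrite (@eq_Rintegral _ _ _ _ (~` Om) g h); last by move=> x /set_mem; exact: hg.
  by rewrite fg addNr.
have [u Eu uh] := energy_riesz h_int h_sq h0 c0_gt0 c0_le.
exists u => // v Ev; rewrite uh// h_split ?eqf ?eqg//.
exact: load_integrable.
Qed.

End NeumannData.

End EnergySpace.
(** * Balls of a local field *)

Section LocalField.
Context {R : realType} {K : fieldType} {abs : K -> R} {q : nat}.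
Hypothesis hK : nonarch_local_field abs q.

Local Notation Q := (q%:R : R).

Lemma abs0 : abs 0 = 0.
Proof. by apply/eqP; rewrite (abs_eq0 hK). Qed.

Lemma abs_value x : x != 0 -> exists m : int, abs x = Q ^ m.
Proof.
move=> x0; have : (abs @` [set x | x != 0]) (abs x) by exists x.
by rewrite (abs_values hK) => -[m _ <-]; exists m.
Qed.

Lemma abs_ge0 x : 0 <= abs x.
Proof.
have [->|/abs_value[m ->]] := eqVneq x 0; first by rewrite abs0.
by rewrite exprz_ge0// ler0n.
Qed.

Lemma abs1 : abs 1 = 1.
Proof.
have : abs 1 != 0 by rewrite (abs_eq0 hK) oner_eq0.
move=> /mulfI; apply; by rewrite -(absM hK) !mulr1.
Qed.

Lemma absN x : abs (- x) = abs x.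
Proof.
rewrite -mulN1r (absM hK); suff -> : abs (-1) = 1 by rewrite mul1r.
apply/eqP; rewrite -(@pexpr_eq1 _ _ 2) ?abs_ge0//.
by rewrite expr2 -(absM hK) mulrNN mulr1 abs1.
Qed.

Lemma absB x y : abs (x - y) = abs (y - x).
Proof. by rewrite -absN opprB. Qed.

Lemma absV x : x != 0 -> abs x^-1 = (abs x)^-1.
Proof.
move=> x0; have ax0 : abs x != 0 by rewrite (abs_eq0 hK).
by apply: (mulfI ax0); rewrite -(absM hK) !divff// abs1.
Qed.

(** The classes of 0 and 1 in the residue field are distinct. *)
Lemma residue_card_gt1 : (1 < q)%N.
Proof.
pose coset a := [set x | abs (x - a) < 1].
have /card_set_bijP[f [f_lt f_inj _]] := abs_residue hK.
have c0 : (coset @` [set a | abs a <= 1]) (coset 0).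
  by exists 0 => //=; rewrite abs0.
have c1 : (coset @` [set a | abs a <= 1]) (coset 1).
  by exists 1 => //=; rewrite abs1.
have f01 : f (coset 0) <> f (coset 1).
  move=> /(f_inj _ _ (mem_set c0) (mem_set c1)) c01.
  have : coset 1 1 by rewrite /coset/= subrr abs0.
  by rewrite -c01 /coset/= subr0 abs1 ltxx.
have := f_lt _ c0; have := f_lt _ c1; rewrite /=.
by move: (f (coset 0)) (f (coset 1)) f01; case: q => [|[|]]// [|]// [|].
Qed.

Let q_gt1 : 1 < Q. Proof. by rewrite ltr1n residue_card_gt1. Qed.

Let q_gt0 : 0 < Q. Proof. exact: lt_trans ltr01 q_gt1. Qed.

Let q_neq0 : Q != 0. Proof. by rewrite gt_eqF. Qed.

Lemma abs_surj (m : int) : exists2 x, x != 0 & abs x = Q ^ m.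
Proof.
have : range (fun m : int => Q ^ m) (Q ^ m) by exists m.
by rewrite -(abs_values hK) => -[x x0 <-]; exists x.
Qed.

(** The valuation is discrete: no value lies strictly between [q^-1] and 1. *)
Lemma abs_lt1 x : abs x < 1 -> abs x <= Q^-1.
Proof.
have [->|/abs_value[m ->]] := eqVneq x 0; first by rewrite abs0 invr_ge0 ltW.
rewrite -[X in _ < X -> _](expr0z Q) ltr_eXz2l// -exprN1 ler_eXz2l//.
Qed.

(** One representative for each residue class. *)
Lemma residue_cover : exists s : seq K, forall x, abs x <= 1 ->
  exists2 a, a \in s & abs (x - a) <= Q^-1.
Proof.
pose coset a := [set x | abs (x - a) < 1].
have fin : finite_set (coset @` [set a | abs a <= 1]).
  by exists q; exact: (abs_residue hK).
have /finite_seqP[s sE] := finite_image (xget 0) fin.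
exists s => x x1; have Cx : coset x x by rewrite /coset/= subrr abs0.
exists (xget 0 (coset x)).
  have : (xget 0 @` (coset @` [set a | abs a <= 1])) (xget 0 (coset x)).
    by exists (coset x) => //; exists x.
  by rewrite sE.
by rewrite absB abs_lt1//; exact: (xgetPex 0 (ex_intro _ _ Cx)).
Qed.

(** Digit expansions: an element of the ring of integers is a representative
    plus [p] times another integer, where [abs p = q^-1]. *)
Let unit_cover (l : nat) : exists s : seq K, forall x, abs x <= 1 ->
  exists2 a, a \in s & abs (x - a) <= Q^-1 ^+ l.
Proof.
elim: l => [|l [s sP]].
  by exists [:: 0] => x x1; exists 0; rewrite ?inE// subr0.
have [s0 s0P] := residue_cover; have [p p0 ap] := abs_surj (-1).
exists [seq a + p * b | a <- s0, b <- s] => x /s0P[a as0 xa].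
have [|b bs xb] := sP ((x - a) / p).
  rewrite (absM hK) absV// ap exprN1 invrK -ler_pdivlMr// mul1r//.
exists (a + p * b); first by apply/allpairsP; exists (a, b).
rewrite (_ : x - _ = p * ((x - a) / p - b)); last by field.
by rewrite (absM hK) ap exprN1 exprS ler_pM2l// invr_gt0.
Qed.

(** Multiplication by an element of absolute value [q^-M] reduces this to the
    ring of integers. *)
Lemma ball_cover (M l : int) : exists s : seq K, forall x, abs x <= Q ^ M ->
  exists2 a, a \in s & abs (x - a) <= Q ^ l.
Proof.
have [c c0 ac] := abs_surj (- M); have [s sP] := unit_cover `|l - M|%N.
exists [seq a / c | a <- s] => x xM.
have [|a as_ xa] := sP (x * c).
  by rewrite (absM hK) ac -invr_expz -ler_pdivlMr ?invr_gt0 ?exprz_gt0// invrK mul1r.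
exists (a / c); first exact: map_f.
rewrite (_ : x - a / c = (x * c - a) / c); last by field.
rewrite (absM hK) absV// ac -invr_expz invrK.
apply: (@le_trans _ _ (Q^-1 ^+ `|l - M|%N * Q ^ M)).
  by rewrite ler_pM2r ?exprz_gt0.
rewrite exprVn exprnN -expfzDr// ler_eXz2l//.
lia.
Qed.

(** The index [(M, l, i)] stands for the [i]-th center in a cover of the ball of
    radius [q^M] by balls of radius [q^l]. *)
Lemma separable : exists d : int * int * nat -> K,
  forall x r, 0 < r -> exists c, abs (x - d c) < r.
Proof.
pose s (M l : int) := sval (cid (ball_cover M l)).
exists (fun c => nth 0 (s c.1.1 c.1.2) c.2) => x r r0.
have [M xM] : exists M : int, abs x <= Q ^ M.
  have [->|/abs_value[m ->]] := eqVneq x 0; last by exists m.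
  by exists 0; rewrite abs0.
have [l lr] : exists l : int, Q ^ l < r.
  have [l _ lP] : \forall l \near \oo, Q^-1 ^+ l < r.
    have : Q^-1 ^+ l @[l --> \oo] --> (0 : R).
      by apply: cvg_expr; rewrite ger0_norm ?invr_ge0 ?ltW// invf_lt1.
    by move=> /cvgr_lt; apply.
  by exists (- l%:Z); rewrite -exprnN -exprVn; exact: (lP l (leqnn l)).
have : exists2 a, a \in s M l & abs (x - a) <= Q ^ l.
  by rewrite /s; case: cid => /= t; apply.
move=> [a /(nthP 0)[i _ <-] xa].
by exists (M, l, i); exact: le_lt_trans lr.
Qed.

End LocalField.
(** * Norm and measure on [K^n] *)

Section HaarMeasure.
Context {R : realType} {K : fieldType} {abs : K -> R} {q : nat}.
Hypothesis hK : nonarch_local_field abs q.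

Local Notation Q := (q%:R : R).

Let q_gt1 : 1 < Q. Proof. by rewrite ltr1n (residue_card_gt1 hK). Qed.

Let q_gt0 : 0 < Q. Proof. exact: lt_trans ltr01 q_gt1. Qed.

Let Q_gt0 (l : int) : 0 < Q ^ l. Proof. exact: exprz_gt0. Qed.

Let abs_ultraB x y z : abs (x - y) <= Num.max (abs (x - z)) (abs (z - y)).
Proof. by rewrite -[x](subrK z) -addrA subrK; exact: (abs_ultra hK). Qed.

Section Ball.
Variable lambda : {measure set (borel abs) -> \bar R}.
Hypothesis hlambda : normalized_haar lambda.

Let ball a (l : int) : set (borel abs) := [set x | abs (x - a) <= Q ^ l].

Let measurable_ball a l : measurable (ball a l).
Proof.
apply: sub_sigma_algebra => x xa; exists (Q ^ l) => // y yx.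
rewrite /ball/=; apply: le_trans (abs_ultraB y a x) _.
by rewrite ge_max (ltW yx).
Qed.

Let lambda_ball a l : lambda (ball a l) = lambda (ball 0 l).
Proof.
rewrite -[RHS](hlambda.1 a)//; congr (lambda _); apply/seteqP; split => x.
  by move=> xa; exists (x - a); rewrite ?subrKC// /ball/= subr0.
by move=> [y + <-]; rewrite /ball/= subr0 addrAC subrr add0r.
Qed.

(** The number of translates that are needed bounds the quotient of the measures. *)
Let lambda_cover (s : seq K) (l : int) (A : set (borel abs)) : measurable A ->
  (forall x, A x -> exists2 a, a \in s & abs (x - a) <= Q ^ l) ->
  (lambda A <= (size s)%:R%:E * lambda (ball 0%R l))%E.
Proof.
elim: s A => [|a s IH] A mA As.
  rewrite mul0e (_ : A = set0) ?measure0//.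
  by apply/seteqP; split => // x /As[].
have h : (lambda (ball a l `|` A `\` ball a l)
    <= lambda (ball a l) + lambda (A `\` ball a l))%E.
  by apply: measureU2 => //; exact: measurableD.
apply: le_trans.
  apply: (@le_trans _ _ (lambda (ball a l `|` A `\` ball a l))).
    apply: le_measure; rewrite ?inE//.
      by apply: measurableU => //; exact: measurableD.
    by move=> x Ax; have [?|?] := pselect (ball a l x); [left|right].
  exact: h.
rewrite (lambda_ball a) [size _]/= -addn1 natrD EFinD ge0_muleDl ?lee_fin//.
rewrite mul1e addeC leeD2r// IH//; first exact: measurableD.
move=> x [Ax xa]; have [b] := As x Ax; rewrite inE => /orP[/eqP->//|bs].
by exists b.
Qed.

(** The unit ball has measure 1; it is covered by finitely many translates of the
    ball of radius [q^l], and vice versa. *)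
Lemma haar_ball_fin_gt0 (l : int) :
  (0 < lambda [set x | (abs x <= Q ^ l)%R] < +oo)%E.
Proof.
have ballE m : [set x | abs x <= Q ^ m] = ball 0 m.
  by apply/seteqP; split => x; rewrite /ball/= subr0.
have unit1 : lambda (ball 0 0) = 1%E by rewrite -ballE expr0z hlambda.2.
have cover m1 m2 : exists s : seq K,
    (lambda (ball 0%R m1) <= (size s)%:R%:E * lambda (ball 0%R m2))%E.
  have [s sP] := ball_cover hK m1 m2; exists s; apply: lambda_cover => // x.
  by rewrite /ball/= subr0; exact: sP.
rewrite ballE; apply/andP; split.
  rewrite lt0e measure_ge0 andbT; apply/eqP => ball0.
  by have [s] := cover 0 l; rewrite unit1 ball0 mule0 lee_fin ler10.
by have [s] := cover l 0; rewrite unit1 mule1 => /le_lt_trans; apply; rewrite ltry.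
Qed.

End Ball.

Section Norm.
Context {n : nat}.
Local Notation norm := (@maxnorm R K abs n).
Implicit Types x y z : 'rV[K]_n.

Lemma maxnorm_leP x c : 0 <= c ->
  norm x <= c <-> forall i, abs (x ord0 i) <= c.
Proof.
move=> c0; split; first by move=> /bigmax_leP[_ xc] i; exact: xc.
by move=> xc; apply/bigmax_leP; split.
Qed.

Lemma maxnorm_ge0 x : 0 <= norm x.
Proof. by rewrite /maxnorm; elim/big_rec: _ => // i y _ y0; rewrite le_max y0 orbT. Qed.

Lemma abs_le_maxnorm x i : abs (x ord0 i) <= norm x.
Proof. by move: i; apply/maxnorm_leP => //; exact: maxnorm_ge0. Qed.

Lemma maxnorm_gt0 x : x <> 0 -> 0 < norm x.
Proof.
move=> x0; rewrite lt_neqAle maxnorm_ge0 andbT; apply/eqP => n0; apply: x0.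
apply/rowP => i; rewrite mxE; apply/eqP; rewrite -(abs_eq0 hK) eq_le.
by rewrite (abs_ge0 hK) n0 abs_le_maxnorm.
Qed.

Lemma maxnormB x y : norm (x - y) = norm (y - x).
Proof.
by rewrite /maxnorm; apply: eq_bigr => i _; rewrite !mxE (absB hK).
Qed.

Lemma maxnorm_ultra x y z : norm (x - y) <= Num.max (norm (x - z)) (norm (z - y)).
Proof.
apply/maxnorm_leP => [|i]; first by rewrite le_max maxnorm_ge0.
rewrite !mxE; apply: le_trans (abs_ultraB _ _ (z ord0 i)) _.
have := abs_le_maxnorm (x - z) i; have := abs_le_maxnorm (z - y) i.
by rewrite !mxE => zy xz; rewrite ge_max !le_max xz zy orbT.
Qed.

Lemma maxnorm_separable : exists d : {ffun 'I_n -> int * int * nat} -> 'rV[K]_n,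
  forall x r, 0 < r -> exists c, norm (x - d c) < r.
Proof.
have [d dP] := separable hK.
exists (fun c => \row_i d (c i)) => x r r0.
exists [ffun i => sval (cid (dP (x ord0 i) r r0))].
apply/bigmax_ltP; split => // i _; rewrite !mxE ffunE.
by case: cid.
Qed.

Lemma norm_open_ball x r : norm_open norm [set y | norm (y - x) < r].
Proof.
move=> y yx; exists r; first exact: le_lt_trans (maxnorm_ge0 _) yx.
move=> z zy; rewrite /=; apply: le_lt_trans (maxnorm_ultra z x y) _.
by rewrite gt_max zy yx.
Qed.

End Norm.

Section KnMeasurable.
Context {n : nat}.
Variable mu : {sigma_finite_measure set (borel (@maxnorm R K abs n)) -> \bar R}.
Local Notation norm := (@maxnorm R K abs n).

Lemma norm_open_measurable (U : set 'rV[K]_n) : norm_open norm U ->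
  measurable (U : set (borel norm)).
Proof. by move=> oU; exact: sub_sigma_algebra. Qed.

Lemma norm_open_measurable_Kn (U : set 'rV[K]_n) : norm_open norm U ->
  measurable (U : set (Kn mu)).
Proof.
move=> oU; apply: sub_caratheodory; apply: sub_sigma_algebra.
exact: norm_open_measurable.
Qed.

(** The product sigma-algebra need not contain every open set of the product, so
    this needs separability: by the ultrametric inequality, [|x - y| < r] holds
    if and only if [x] and [y] are in a common ball of radius [r], and its center
    may be taken in a countable dense set. *)
Lemma measurable_maxnorm_sub :
  measurable_fun setT (fun z : Kn mu * Kn mu => norm (z.1 - z.2)).
Proof.
move=> mT; apply: (measurability _ (RGenInftyO.measurableE R)) => //.
move=> _ [_ [r ->] <-]; rewrite setTI.
have [r0|r0] := leP r 0.
  rewrite (_ : _ @^-1` _ = set0)//; apply/seteqP; split => // z /=.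
  by rewrite in_itv/= => /lt_le_trans/(_ r0); rewrite ltNge maxnorm_ge0.
have [d dP] := @maxnorm_separable n.
pose B c : set (Kn mu) := [set y | norm (y - d c) < r].
have mB c : measurable (B c) by apply: norm_open_measurable_Kn; exact: norm_open_ball.
rewrite (_ : _ @^-1` _ = \bigcup_c (B c `*` B c)).
  by apply: countable_bigcupT_measurable => // c; exact: measurableX.
apply/seteqP; split => -[x y] /=.
  rewrite in_itv/= => xy; have [c xc] := dP x r r0; exists c => //.
  split; rewrite /B//=; apply: le_lt_trans (maxnorm_ultra y (d c) x) _.
  by rewrite gt_max maxnormB xy.
move=> [c _ [xc yc]]; rewrite in_itv/=.
apply: le_lt_trans (maxnorm_ultra x y (d c)) _.
by rewrite gt_max xc maxnormB.
Qed.

Lemma measurable_maxnorm : measurable_fun setT (norm : Kn mu -> R).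
Proof.
move=> mT; apply: (measurability _ (RGenInftyO.measurableE R)) => //.
move=> _ [_ [r ->] <-]; rewrite setTI.
rewrite (_ : _ @^-1` _ = [set y | norm (y - 0) < r]).
  by apply: norm_open_measurable_Kn; exact: norm_open_ball.
by apply/seteqP; split => y; rewrite /= in_itv/= subr0.
Qed.

Variable N : int.

Let Omega_open : norm_open norm (Omega q mu N).
Proof.
move=> x xN; exists (Q ^ N) => // y yx.
have := maxnorm_ultra y 0 x; rewrite !subr0 => /le_trans; apply.
by rewrite ge_max (ltW yx).
Qed.

Lemma measurable_Omega : measurable (Omega q mu N).
Proof. exact: norm_open_measurable_Kn. Qed.

Lemma haarc_Omega (lambda : {measure set (borel abs) -> \bar R}) :
  normalized_haar lambda -> is_product_measure lambda mu ->
  (0 < haarc mu (Omega q mu N) < +oo)%E.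
Proof.
move=> hlambda hmu.
have -> : haarc mu (Omega q mu N) = mu (Omega q mu N).
  rewrite /haarc /completed_measure_extension measurable_mu_extE//.
  exact: norm_open_measurable.
have mball : measurable ([set y | abs y <= Q ^ N] : set (borel abs)).
  apply: sub_sigma_algebra => x xN; exists (Q ^ N) => // y yx.
  have := abs_ultraB y 0 x; rewrite !subr0 => /le_trans; apply.
  by rewrite ge_max (ltW yx).
have -> : mu (Omega q mu N)
    = (\prod_(i < n) lambda [set y | (abs y <= Q ^ N)%R])%E.
  rewrite -(hmu (fun=> _) (fun=> mball)); congr (mu _).
  by apply/seteqP; split => x; [move=> /maxnorm_leP; apply; exact: ltW|
    move=> xN; apply/maxnorm_leP => //; exact: ltW].
elim/big_rec: _ => [|i x _ /andP[x0 xoo]]; first by rewrite lte01 ltry.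
have /andP[l0 loo] := haar_ball_fin_gt0 hlambda N.
by rewrite mule_gt0// lte_mul_pinfty ?ltW// ge0_fin_numE ?ltW.
Qed.

End KnMeasurable.
End HaarMeasure.
(** * The Neumann problem on a ball *)

Section NeumannProblem.
Context {R : realType} {K : fieldType} {abs : K -> R} {q : nat}.
Hypothesis hK : nonarch_local_field abs q.
Context {n : nat} {alpha : R}.
Hypothesis alpha_gt0 : 0 < alpha.
Variable N : int.
Variable mu : {sigma_finite_measure set (borel (@maxnorm R K abs n)) -> \bar R}.
Hypothesis Om_fin_gt0 : (0 < haarc mu (Omega q mu N) < +oo)%E.

Local Notation Q := (q%:R : R).
Local Notation norm := (@maxnorm R K abs n).
Local Notation Om := (Omega q mu N).
Local Notation m := (haarc mu).
Local Notation k := (@jump_kernel R K abs n alpha).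
Local Notation E := (energy_space m Om k).
Local Notation cN := (@cna R q n alpha).

Let q_gt1 : 1 < Q. Proof. by rewrite ltr1n (residue_card_gt1 hK). Qed.

Let q_gt0 : 0 < Q. Proof. exact: lt_trans ltr01 q_gt1. Qed.

Let Q_gt0 (l : int) : 0 < Q ^ l. Proof. exact: exprz_gt0. Qed.

Let na_gt0 : 0 < n%:R + alpha. Proof. by rewrite ltr_wpDl. Qed.

Let mOm : measurable (Om : set (Kn mu)). Proof. exact: (measurable_Omega hK). Qed.

Let mOmc : measurable (~` Om : set (Kn mu)). Proof. exact: measurableC. Qed.

Let Om_gt0 : (0 < m Om)%E. Proof. by case/andP: Om_fin_gt0. Qed.

Let Om_fin : (m Om < +oo)%E. Proof. by case/andP: Om_fin_gt0. Qed.

Lemma cna_gt0 : 0 < cN.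
Proof.
have Q1 a : 0 < a -> 1 < Q `^ a.
  move=> a0; have := @gt0_ltr_powR R a a0 1 Q.
  by rewrite !nnegrE powR1 => ->//; exact: ltW.
apply: divr_gt0; first by rewrite subr_gt0 Q1.
by rewrite subr_gt0 -opprD powRN invf_lt1 ?powR_gt0// Q1// addrC.
Qed.

Let measurable_k : measurable_fun setT (fun z : Kn mu * Kn mu => k z.1 z.2).
Proof.
rewrite (_ : (fun z => _) = (fun z : Kn mu * Kn mu =>
    norm (z.1 - z.2) `^ (- (n%:R + alpha)))); last first.
  by apply/funext => z; rewrite powRN.
apply: (measurableT_comp (measurable_powR _)).
exact: (measurable_maxnorm_sub hK).
Qed.

Let k_ge0 x y : 0 <= k x y.
Proof. by rewrite invr_ge0 powR_ge0. Qed.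

(** The value of the jump kernel between [x] and any point of [Omega] when [x] is
    outside, continued inside by the kernel at distance [q^N], which no two
    points of [Omega] exceed. *)
Definition far_kernel (x : 'rV[K]_n) : R :=
  (Num.max (norm x) (Q ^ N) `^ (n%:R + alpha))^-1.

Local Notation kap := far_kernel.

Let measurable_kap : measurable_fun setT (kap : Kn mu -> R).
Proof.
rewrite (_ : kap = (fun x => Num.max (norm x) (Q ^ N) `^ (- (n%:R + alpha)))); last first.
  by apply/funext => z; rewrite powRN.
apply: (measurableT_comp (measurable_powR _)).
apply: measurable_maxr; [exact: (measurable_maxnorm hK)|exact: measurable_cst].
Qed.

Let kap_gt0 x : 0 < kap x.
Proof. by rewrite invr_gt0 powR_gt0// lt_max Q_gt0 orbT. Qed.

Let kap_ge0 x : 0 <= kap x. Proof. exact: ltW. Qed.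

Let kap_le (x y : Kn mu) : Om y -> x <> y -> kap x <= k x y.
Proof.
move=> Oy xy.
have norm0 : 0 < norm (x - y).
  by apply: (maxnorm_gt0 hK) => /eqP; rewrite subr_eq0 => /eqP.
rewrite lef_pV2 ?posrE ?powR_gt0 ?lt_max ?Q_gt0 ?orbT//.
apply: ge0_ler_powR; rewrite ?nnegrE ?(ltW norm0) ?(ltW na_gt0)//.
  by rewrite le_max maxnorm_ge0.
apply: le_trans (maxnorm_ultra hK x y 0) _.
rewrite subr0 sub0r ge_max !le_max lexx/=.
by rewrite -sub0r (maxnormB hK) subr0; apply/orP; right.
Qed.

Let kap_Om (x : Kn mu) : Om x -> kap x = ((Q ^ N) `^ (n%:R + alpha))^-1.
Proof. by move=> Ox; rewrite /kap max_r. Qed.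

(** In an ultrametric space all points of [Omega] are equally far from [x]. *)
Let k_far (x y : Kn mu) : (~` Om) x -> Om y -> k x y = kap x.
Proof.
move=> /negP; rewrite /Omega/= -ltNge => Nx Oy.
have yx : norm y < norm x by exact: le_lt_trans Nx.
rewrite /jump_kernel /kap max_l ?(ltW Nx)//; congr (_ `^ _)^-1.
apply/eqP; rewrite eq_le; apply/andP; split.
  apply: le_trans (maxnorm_ultra hK x y 0) _.
  by rewrite subr0 ge_max lexx (maxnormB hK) subr0 ltW.
have := maxnorm_ultra hK x 0 y; rewrite !subr0 le_max.
by rewrite [norm x <= norm y]leNgt yx orbF.
Qed.

(** By [k_far] the kernel comes out of the integral over [Omega] in [N_alpha psi],
    which leaves the integral of a bounded function over a set of finite
    measure. *)
Lemma neumann_datum_bound (g : Kn mu -> R) (psi : 'rV[K]_n -> R) (M : R) :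
  (forall x, `|psi x| <= M) -> locally_constant abs q psi ->
  {ae m, forall x, (~` Om) x -> Nalpha q mu alpha N psi x = g x} ->
  exists2 C, 0 <= C & {ae m, forall x, (~` Om) x -> `|g x| <= C * kap x}.
Proof.
move=> psiM [l psi_l] psi_g.
have M0 : 0 <= M by exact: le_trans (psiM 0).
have mpsi : measurable_fun setT (psi : Kn mu -> R).
  move=> _ Y _; rewrite setTI; apply: (norm_open_measurable_Kn mu) => x Yx.
  exists (Q ^ (- l)); first exact: Q_gt0.
  move=> y yx; have := psi_l x (y - x) (ltW yx).
  by rewrite addrC subrK /preimage/= => ->.
pose s := fine (m Om).
have s0 : 0 <= s by rewrite fine_ge0.
exists (cN * (2 * M * s)).
  by apply: mulr_ge0; [exact: (ltW cna_gt0)|rewrite !mulr_ge0].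
apply: filterS psi_g => x gx Ox; rewrite -(gx Ox) /Nalpha.
rewrite normrM (gtr0_norm cna_gt0) -(mulrA cN) ler_wpM2l ?(ltW cna_gt0)//.
have mpx : measurable_fun Om (fun y : Kn mu => (psi x - psi y) * kap x).
  apply: measurable_funM; last exact: measurable_cst.
  apply: measurable_funB; first exact: measurable_cst.
  exact: measurable_funTS.
have psi_le y : `|(psi x - psi y) * kap x| <= 2 * M * kap x.
  rewrite normrM (ger0_norm (kap_ge0 x)) ler_wpM2r//.
  apply: le_trans (ler_normB _ _) _.
  by have := psiM x; have := psiM y; lra.
have ipx : m.-integrable Om (EFin \o (fun y : Kn mu => (psi x - psi y) * kap x)).
  apply: measurable_bounded_integrable => //.
  exists (2 * M * kap x); split; first exact: num_real.
  by move=> r rM y _; exact: le_trans (psi_le y) (ltW rM).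
have -> : \int[m]_(y in Om) ((psi x - psi y) * k x y)
        = \int[m]_(y in Om) ((psi x - psi y) * kap x).
  by apply: eq_Rintegral => y /set_mem Oy; rewrite k_far.
apply: le_trans (le_normr_Rintegral mOm ipx) _.
rewrite [leRHS](_ : _ = \int[m]_(y in Om) (2 * M * kap x)); last first.
  by rewrite Rintegral_cst// mulrAC.
apply: le_Rintegral => //; first exact: integrable_norm.
apply: measurable_bounded_integrable => //.
exists (2 * M * kap x); split; first exact: num_real.
by move=> r rM y _ /=; rewrite ger0_norm ?(ltW rM)// !mulr_ge0.
Qed.

Let jumpE u : (\int[m \x m]_(z in cross q N)
    ((`|u z.1 - u z.2| ^+ 2 * k z.1 z.2)%:E))%E = energy m Om k u.
Proof.
by apply: eq_integral => z _; rewrite real_normK ?num_real.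
Qed.

Lemma HspaceP rho u : Hspace q mu alpha N rho u <->
  E u /\ (\int[m]_(x in ~` Om) (((Num.sqrt `|rho x| * u x) ^+ 2)%:E) < +oo)%E.
Proof.
rewrite /Hspace /Hnorm jumpE.
set A := (\int[m]_(x in Om) _)%E; set B := (\int[m]_(x in ~` Om) _)%E.
have AE : A = sqint m Om (fun=> 1) u.
  by apply: eq_integral => x _; rewrite mulr1.
have A0 : (0 <= A)%E by apply: integral_ge0 => x _; rewrite lee_fin sqr_ge0.
have B0 : (0 <= B)%E by apply: integral_ge0 => x _; rewrite lee_fin sqr_ge0.
have C0 : (0 <= energy m Om k u)%E.
  by apply: integral_ge0 => x _; rewrite lee_fin mulr_ge0// sqr_ge0.
split=> [[mu_u /lty_poweRy]|[[mu_u [_ u2] [_ Eu]] Boo]].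
  rewrite invr_neq0// => /(_ isT) ABC.
  have Aoo : (A < +oo)%E.
    by apply: le_lt_trans ABC; rewrite -addeA leeDl// adde_ge0.
  have Boo : (B < +oo)%E.
    by apply: le_lt_trans ABC; rewrite addeAC leeDr// adde_ge0.
  have Coo : (energy m Om k u < +oo)%E.
    by apply: le_lt_trans ABC; rewrite leeDr// adde_ge0.
  split=> //; split=> //; split=> //; rewrite -?AE//.
    exact: measurable_funTS.
  by apply: measurable_funTS; exact: measurable_increment.
split=> //; apply: poweR_lty; apply: lte_add_pinfty => //.
by apply: lte_add_pinfty => //; rewrite AE.
Qed.

Lemma Hspace0E u : Hspace q mu alpha N (cst 0) u <-> E u.
Proof.
split=> [/HspaceP[]//|Eu]; apply/HspaceP; split=> //.
under eq_integral do rewrite normr0 sqrtr0 mul0r expr0n/=.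
by rewrite integral0.
Qed.

Section Datum.
Variable g : Kn mu -> R.
Hypothesis g_int : L1_Omegac q mu N g.
Variable C : R.
Hypothesis C_ge0 : 0 <= C.
Hypothesis g_le : {ae m, forall x, (~` Om) x -> `|g x| <= C * kap x}.

(** For such [g], the weight [|g|] adds no condition, and solutions and test
    functions range over the same space. *)
Lemma HspaceE u : Hspace q mu alpha N g u <-> E u.
Proof.
split=> [/HspaceP[]//|Eu]; apply/HspaceP; split=> //.
exact: (sqint_dominated_weight mOm Om_gt0 Om_fin measurable_k k_ge0
  measurable_kap kap_gt0 kap_le Eu mOmc g_int C_ge0 g_le).
Qed.

Let energy_dotE u v : \int[(m \x m)%E]_(z in cross q N)
    ((u z.1 - u z.2) * (v z.1 - v z.2) * k z.1 z.2) = energy_dot m Om k u v.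
Proof. by apply: eq_Rintegral => z _. Qed.

Lemma weak_solutionP f u : weak_solution q mu alpha N f g u <->
  E u /\ forall v, E v -> cN / 2 * energy_dot m Om k u v
    = \int[m]_(x in Om) (f x * v x) + \int[m]_(y in ~` Om) (g y * v y).
Proof.
split=> -[Hu uf]; split; [exact: (Hspace0E u).1| |exact: (Hspace0E u).2|].
  by move=> v Ev; rewrite -energy_dotE; exact: (uf v ((HspaceE v).2 Ev)).
by move=> v Hv; have := uf v ((HspaceE v).1 Hv); rewrite -energy_dotE.
Qed.

(** Testing with the constant function 1. *)
Lemma weak_solution_compatible f u : weak_solution q mu alpha N f g u ->
  \int[m]_(x in Om) f x = - (\int[m]_(y in ~` Om) g y).
Proof.
move=> /weak_solutionP[Eu uf].
have E1 : E (fun=> 1) by exact: energy_space_cst.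
have := uf _ E1; rewrite (_ : energy_dot _ _ _ _ _ = 0); last first.
  rewrite /energy_dot /dot (@eq_Rintegral _ _ _ _ _ (fun=> 0)).
    by rewrite Rintegral_cst ?mul0r//; do !apply: measurableC => //;
       apply: measurableX.
  by move=> z _; rewrite /increment subrr mulr0 mul0r.
rewrite mulr0 => /esym/eqP; rewrite addr_eq0 => /eqP.
rewrite (@eq_Rintegral _ _ _ _ Om f); last by move=> x _; rewrite mulr1.
rewrite (@eq_Rintegral _ _ _ _ (~` Om) g)//; by move=> x _; rewrite mulr1.
Qed.

Lemma weak_solution_exists f : L2_Omega q mu N f ->
  \int[m]_(x in Om) f x = - (\int[m]_(y in ~` Om) g y) ->
  exists u, weak_solution q mu alpha N f g u.
Proof.
move=> [mf f2] fg.
have c0_gt0 : 0 < (((Q ^ N) `^ (n%:R + alpha))^-1) by rewrite invr_gt0 powR_gt0.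
have c0_le (x : Kn mu) : Om x -> ((Q ^ N) `^ (n%:R + alpha))^-1 <= kap x.
  by move=> Ox; rewrite kap_Om.
have [u Eu uP] := energy_neumann mOm Om_gt0 Om_fin measurable_k k_ge0
  measurable_kap kap_gt0 kap_le mf f2 g_int C_ge0 c0_gt0 g_le c0_le fg.
(* this is [(2 / cN) *: u], in the form to which linearity applies *)
exists ((2 / cN - 1) *: u + u); apply/weak_solutionP; split.
  exact: energy_space_lin.
move=> v Ev; rewrite energy_dot_lin// -uP//.
move: (energy_dot _ _ _ _ _) (gt_eqF cna_gt0) => e cN0.
by field; rewrite cN0.
Qed.

(** The difference of two solutions is an admissible test function, so that it
    has zero energy. *)
Lemma weak_solution_unique f u1 u2 : weak_solution q mu alpha N f g u1 ->
  weak_solution q mu alpha N f g u2 ->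
  exists c, {ae m, forall x, u2 x = u1 x + c}.
Proof.
move=> /weak_solutionP[E1 u1f] /weak_solutionP[E2 u2f].
pose w : Kn mu -> R := (-1) *: u1 + u2.
have Ew : E w by exact: energy_space_lin.
have w0 : energy_dot m Om k w w = 0.
  rewrite {1}/w energy_dot_lin//.
  have cN2 : cN / 2 != 0 by rewrite mulf_neq0 ?invr_neq0// gt_eqF// cna_gt0.
  apply: (mulfI cN2); rewrite mulr0 mulrDr mulrCA u1f// u2f//.
  by rewrite mulN1r addNr.
exists (mean m Om w).
have := energy_constant mOm Om_gt0 Om_fin measurable_k k_ge0 measurable_kap
  kap_gt0 kap_le Ew w0.
by apply: filterS => x <-; rewrite /w !fctE /GRing.scale/=; ring.
Qed.

End Datum.

End NeumannProblem.
Theorem theorem6p1 (R : realType) (K : fieldType) (abs : K -> R) (q : nat)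
    (hK : nonarch_local_field abs q)
    (n : nat) (hn : (1 <= n)%N) (alpha : R) (halpha : 0 < alpha) (N : int)
    (lambda : {measure set (borel abs) -> \bar R})
    (hlambda : normalized_haar lambda)
    (mu : {sigma_finite_measure set (borel (@maxnorm R K abs n)) -> \bar R})
    (hmu : is_product_measure lambda mu)
    (f g : Kn mu -> R)
    (hf : L2_Omega q mu N f) (hg : L1_Omegac q mu N g)
    (hpsi : exists psi : 'rV[K]_n -> R,
       [/\ exists M : R, forall x, `|psi x| <= M,
           locally_constant abs q psi
         & {ae haarc mu, forall x, (~` Omega q mu N) x ->
              Nalpha q mu alpha N psi x = g x}]) :
  ((exists u : Kn mu -> R, weak_solution q mu alpha N f g u) <->
     \int[haarc mu]_(x in Omega q mu N) f x
     = - (\int[haarc mu]_(y in ~` Omega q mu N) g y))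
  /\
  (\int[haarc mu]_(x in Omega q mu N) f x
     = - (\int[haarc mu]_(y in ~` Omega q mu N) g y) ->
   forall u1 u2 : Kn mu -> R,
     weak_solution q mu alpha N f g u1 -> weak_solution q mu alpha N f g u2 ->
     exists c : R, {ae haarc mu, forall x, u2 x = u1 x + c}).
Proof.
have [psi [[M psiM] psi_lc psi_g]] := hpsi.
have Om_fin_gt0 := haarc_Omega hK N hlambda hmu.
have [C C_ge0 g_le] := neumann_datum_bound hK halpha Om_fin_gt0 psiM psi_lc psi_g.
split; first split.
- by move=> [u]; exact: (weak_solution_compatible hK halpha Om_fin_gt0 hg C_ge0 g_le).
- exact: (weak_solution_exists hK halpha Om_fin_gt0 hg C_ge0 g_le hf).
- move=> _ u1 u2.
  exact: (weak_solution_unique hK halpha Om_fin_gt0 hg C_ge0 g_le).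
Qed.
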